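(* Let $d,r\in\mathbb{N}$ and let $f_1,\dots,f_r\in\mathcal{A}:=\mathbb{R}[x_1,\dots,x_d]$ be such that the semialgebraic set $$\mathcal{K}(f_1,\dots,f_r):=\{x\in\mathbb{R}^d : f_1(x)\ge 0,\dots,f_r(x)\ge 0\}$$ is compact. Then there exist polynomials $p_1,\dots,p_s\in\mathbb{R}[x_1,\dots,x_d]$, $s\in\mathbb{N}$, such that the semiring $\mathcal{S}$ of $\mathcal{A}$ generated by $f_1,\dots,f_r,p_1^2,\dots,p_s^2$ is Archimedean. If $q\in\mathbb{R}[x_1,\dots,x_d]$ satisfies $q(x)>0$ for all $x\in\mathcal{K}(f_1,\dots,f_r)$, then $q$ is a finite sum of polynomials of the form $$\alpha\, f_1^{e_1}\cdots f_r^{e_r}\, f_1^{2n_1}\cdots f_r^{2n_r}\, p_1^{2k_1}\cdots p_s^{2k_s}, \qquad ( * )$$ where $\alpha\in(0,+\infty)$, $e_1,\dots,e_r\in\{0,1\}$, $n_1,\dots,n_r,k_1,\dots,k_s\in\mathbb{N}_0$. Further, each linear functional on $\mathbb{R}[x_1,\dots,x_d]$ that is nonnegative on all polynomials of the form $( * )$ with $\alpha=1$ is a $\mathcal{K}(f_1,\dots,f_r)$-moment functional.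
   Context: A convex cone in a commutative unital $\mathbb{R}$-algebra $\mathcal{A}$ is a non-empty subset closed under addition and under multiplication by real scalars $\lambda\ge 0$. A semiring of $\mathcal{A}$ is a convex cone $\mathcal{S}$ with $1\in\mathcal{S}$ and $\mathcal{S}\cdot\mathcal{S}\subseteq\mathcal{S}$; the semiring generated by a set is the smallest semiring containing it (for finitely many elements $h_1,\dots,h_m$: all finite sums of $\alpha\,h_1^{n_1}\cdots h_m^{n_m}$ with $\alpha\ge0$, $n_i\in\mathbb{N}_0$). $\mathcal{S}$ is Archimedean if for every $a\in\mathcal{A}$ there is $\lambda\in(0,\infty)$ with $\lambda 1-a\in\mathcal{S}$ and $\lambda 1+a\in\mathcal{S}$. For a closed set $\mathcal{K}\subseteq\mathbb{R}^d$, a linear functional $L$ on $\mathbb{R}[x_1,\dots,x_d]$ is a $\mathcal{K}$-moment functional if there is a Radon measure $\mu$ supported on $\mathcal{K}$ with $L(p)=\int_{\mathcal{K}}p(x)\,d\mu(x)$ for all $p\in\mathbb{R}[x_1,\dots,x_d]$. *)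

(* Defs.v *)
From HB Require Import structures.
From mathcomp Require Import all_boot all_order all_algebra.
(* The notations of mpoly clash with those of MathComp-Analysis, so they are
   left out and the ones needed here are redeclared below.  Importing mpoly
   first lets the MathComp-Analysis names (isMeasure, ...) take precedence. *)
From mathcomp Require mpoly.
Import -(notations) mpoly.
From mathcomp Require Import all_classical all_reals all_analysis.

Set Implicit Arguments.
Unset Strict Implicit.
Unset Printing Implicit Defensive.

Import Order.TTheory GRing.Theory Num.Theory.
Import numFieldNormedType.Exports.

Local Open Scope classical_set_scope.
Local Open Scope ring_scope.

Notation "{ 'mpoly' T [ n ] }" := (mpoly n T)
  (at level 0, T, n at level 2, format "{ 'mpoly'  T [ n ] }").
Notation "p .@[ v ]" := (meval v p)
  (at level 1, left associativity, format "p .@[ v ]").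

Section Semirings.
Context {R : realType} {A : comAlgType R}.
Implicit Types (C S G : set A).

Definition convex_cone C : Prop :=
  [/\ C !=set0,
      forall a b, C a -> C b -> C (a + b)
    & forall (lambda : R) a, 0 <= lambda -> C a -> C (lambda *: a)].

Definition is_semiring S : Prop :=
  [/\ convex_cone S, S 1 & forall a b, S a -> S b -> S (a * b)].

Definition semiring_gen G : set A := smallest is_semiring G.

Definition archimedean S : Prop :=
  forall a, exists2 lambda : R, 0 < lambda &
    S (lambda *: 1 - a) /\ S (lambda *: 1 + a).

End Semirings.

Section Moments.
Context {R : realType} {d : nat}.

Definition semialg_set r (f : 'I_r -> {mpoly R[d]}) : set 'rV[R]_d :=
  [set x | forall i, 0 <= (f i).@[x ord0]].

(* R^d with its Borel sigma-algebra *)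
Definition borel_rV := g_sigma_algebraType (@open 'rV[R]_d).

Definition radon (mu : {measure set borel_rV -> \bar R}) : Prop :=
  (forall C : set 'rV[R]_d, compact C -> (mu C < +oo)%E) /\
  (forall B : set borel_rV, measurable B ->
     mu B = ereal_sup [set mu C | C in
              [set C : set 'rV[R]_d | compact C /\ C `<=` B]]).

Definition supported_on (mu : {measure set borel_rV -> \bar R})
    (K : set 'rV[R]_d) : Prop :=
  mu (~` K) = 0%E.

(* Integrability is required explicitly because the integral is a total
   operator on all functions. *)
Definition moment_functional (K : set 'rV[R]_d)
    (L : {scalar {mpoly R[d]}}) : Prop :=
  exists mu : {measure set borel_rV -> \bar R},
    [/\ radon mu, supported_on mu K
      & forall p : {mpoly R[d]},
          mu.-integrable K (fun x : borel_rV => (p.@[x ord0])%:E) /\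
          (L p)%:E = (\int[mu]_(x in K) (p.@[x ord0])%:E)%E].

(* The product (f^e f^(2n) p^(2k)); the booleans e i are exponents in {0,1}. *)
Definition semiring_monomial r s
    (f : 'I_r -> {mpoly R[d]}) (p : 'I_s -> {mpoly R[d]})
    (e : 'I_r -> bool) (n : 'I_r -> nat) (k : 'I_s -> nat) : {mpoly R[d]} :=
  (\prod_(i < r) f i ^+ e i) * (\prod_(i < r) f i ^+ (2 * n i)) *
  (\prod_(j < s) p j ^+ (2 * k j)).

End Moments.

Arguments borel_rV : clear implicits.

(* Main.v *)
Require Import Defs.
From HB Require Import structures.
From mathcomp Require Import all_boot all_order all_algebra.
From mathcomp Require Import polyorder polyrcf qe_rcf_th.
From mathcomp Require Import generic_quotient ring lra zify.
From mathcomp Require mpoly.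
Import -(notations) mpoly.
From mathcomp Require Import all_classical all_reals all_analysis.
From mathcomp Require Import measurable_realfun.

Set Implicit Arguments.
Unset Strict Implicit.
Unset Printing Implicit Defensive.

Import Order.TTheory GRing.Theory Num.Theory.
Import numFieldNormedType.Exports.

Local Open Scope classical_set_scope.
Local Open Scope quotient_scope.
Local Open Scope ring_scope.

(** Let T be the semiring generated by the f_i and all squares.  Everything rests
on T being Archimedean, which uses the compactness of K = K(f).

Choose rho with g := rho - sum x_i^2 > 0 on K.  If -1 were not in T - g T, the
preordering T - g T would extend to an ordering of the polynomial ring, that is
to a homomorphism into an ordered field sending the f_i to nonnegative
elements and g to a nonpositive one [preordering_field]; by Artin and Lang such
signs are then met at a point of R^d [artin_lang], which contradicts g > 0 on K.
Hence g s = 1 + t with s, t in T, and an identity of Woermann [woermann] turns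
this into m - sum x_i^2 in T for some real m, whence T is Archimedean
[archimedean_preordering].

The Artin-Lang step is Tarski's transfer principle.  An ordered field is
embedded into a real closed field F [real_closure]: a polynomial p with
p(a) < 0 < p(b) has no identity 1 + sum c_i g_i^2 = p h with all c_i >= 0
[sign_change_no_identity], so that a root can be adjoined [adjoin_root], and an
ultraproduct of finite towers of such extensions adjoins all roots at once.
Variables are then eliminated one by one: over F and over R alike, the number
of roots of a polynomial satisfying given sign conditions is a Cauchy index,
computed by a pseudo-remainder sequence from the signs of finitely many
coefficients [cindexR_transfer, sign_transfer].

That the bounds k - x_i and k + x_i lie in T involves finitely many squares;
these are the p_j^2, and the semiring S that they generate with the f_i is
Archimedean since the elements bounded with respect to a semiring form a
subalgebra.

For q > 0 on K: if -1 is not in S - q S, a maximal S-module containing S - q S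
defines a character of the algebra, that is evaluation at a point of K where
q <= 0 [semiring_character].  So q s = 1 + t with s, t in S, and a descent on
the constant r in q + r in S gives q in S [semiring_of_multiple].  The products
of the statement span S as a cone.

A functional L nonnegative on these products is therefore nonnegative on
polynomials nonnegative on K.  It extends to a positive functional on the
functions bounded on K [positive_extension]; its values on indicators form a
finitely additive content, which inner and then outer regularization turn into
a Radon measure [cmeasure_radon].  Slicing a function into n levels bounds its
integral by its value under L, and the same bound for the opposite function
gives equality [riesz_moment]. *)

(** * Ordered fields as quotients of structures satisfying the axioms up to equivalence *)

(** The axioms of an ordered field, with equality replaced by the equivalence
attached to a total preorder.  Both fractions over a ring with a prime cone and
terms evaluated in an ultraproduct have this form; the inverse is only required
to exist, which spares its compatibility with the equivalence. *)
Record preofield := PreOField {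
  pcar :> Type;
  pzero : pcar; pone : pcar;
  padd : pcar -> pcar -> pcar;
  pmul : pcar -> pcar -> pcar;
  popp : pcar -> pcar;
  ple : pcar -> pcar -> Prop;
  peq := fun x y => ple x y /\ ple y x;
  ple_refl : forall x, ple x x;
  ple_trans : forall y x z, ple x y -> ple y z -> ple x z;
  ple_total : forall x y, ple x y \/ ple y x;
  ple_add : forall x y z, ple x y -> ple (padd x z) (padd y z);
  ple_mul : forall x y, ple pzero x -> ple pzero y -> ple pzero (pmul x y);
  pmul_congr : forall x y z, peq x y -> peq (pmul x z) (pmul y z);
  paddA : forall x y z, peq (padd x (padd y z)) (padd (padd x y) z);
  paddC : forall x y, peq (padd x y) (padd y x);
  padd0 : forall x, peq (padd pzero x) x;
  paddN : forall x, peq (padd (popp x) x) pzero;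
  pmulA : forall x y z, peq (pmul x (pmul y z)) (pmul (pmul x y) z);
  pmulC : forall x y, peq (pmul x y) (pmul y x);
  pmul1 : forall x, peq (pmul pone x) x;
  pmulD : forall x y z, peq (pmul (padd x y) z) (padd (pmul x z) (pmul y z));
  pone_neq0 : ~ peq pone pzero;
  pinv_ex : forall x, ~ peq x pzero -> exists y, peq (pmul y x) pone
}.

Section OrderedFieldQuotient.
Variable D : preofield.

Definition ofcar : Type := D.
HB.instance Definition _ := gen_eqMixin ofcar.
HB.instance Definition _ := gen_choiceMixin ofcar.

Notation "x ~= y" := (@peq D x y) (at level 70).

Lemma peq_refl x : x ~= x. Proof. by split; apply: ple_refl. Qed.
Lemma peq_sym x y : x ~= y -> y ~= x. Proof. by case. Qed.
Lemma peq_trans y x z : x ~= y -> y ~= z -> x ~= z.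
Proof.
by move=> [xy yx] [yz zy]; split; [apply: ple_trans yz|apply: ple_trans yx].
Qed.

Definition peqb (x y : ofcar) : bool := `[< x ~= y >].
Lemma peqb_equiv : equiv_class_of peqb.
Proof.
split=> [x|x y|y x z]; first by apply/asboolP; apply: peq_refl.
  by apply/asboolP/asboolP; apply: peq_sym.
by move=> /asboolP xy /asboolP yz; apply/asboolP; apply: peq_trans yz.
Qed.
Canonical peqb_equivRel := EquivRelPack peqb_equiv.

Definition ofq := {eq_quot peqb_equivRel}.
HB.instance Definition _ := Choice.on ofq.
HB.instance Definition _ := EqQuotient.on ofq.

Definition ofpi (x : ofcar) : ofq := \pi_ofq x.

Lemma ofpi_eq x y : ofpi x = ofpi y <-> x ~= y.
Proof.
split; first by move=> /eqmodP/asboolP.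
by move=> xy; apply/eqmodP/asboolP.
Qed.

Lemma ofpi_repr (a : ofq) : ofpi (repr a) = a. Proof. exact: reprK. Qed.

Lemma padd_congr x y z : x ~= y -> padd x z ~= padd y z.
Proof. by case=> xy yx; split; apply: ple_add. Qed.

Lemma padd_congr2 x x' y y' : x ~= x' -> y ~= y' -> padd x y ~= padd x' y'.
Proof.
move=> xx yy; apply: (peq_trans (padd_congr y xx)).
apply: (peq_trans (paddC _ _)); apply: (peq_trans (padd_congr x' yy)).
exact: paddC.
Qed.

Lemma pmul_congr2 x x' y y' : x ~= x' -> y ~= y' -> pmul x y ~= pmul x' y'.
Proof.
move=> xx yy; apply: (peq_trans (pmul_congr y xx)).
apply: (peq_trans (pmulC _ _)); apply: (peq_trans (pmul_congr x' yy)).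
exact: pmulC.
Qed.

Definition ofadd (a b : ofq) := ofpi (padd (repr a) (repr b)).
Definition ofmul (a b : ofq) := ofpi (pmul (repr a) (repr b)).
Definition ofopp (a : ofq) := ofpi (popp (repr a)).

Lemma reprpi x : (repr (ofpi x) : ofcar) ~= x.
Proof. by apply/ofpi_eq; rewrite ofpi_repr. Qed.

Lemma ofaddE x y : ofadd (ofpi x) (ofpi y) = ofpi (padd x y).
Proof. by apply/ofpi_eq; apply: padd_congr2; apply: reprpi. Qed.
Lemma ofmulE x y : ofmul (ofpi x) (ofpi y) = ofpi (pmul x y).
Proof. by apply/ofpi_eq; apply: pmul_congr2; apply: reprpi. Qed.

Lemma ofqW (P : ofq -> Prop) : (forall x, P (ofpi x)) -> forall a, P a.
Proof. by move=> H a; rewrite -(ofpi_repr a). Qed.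

Lemma ofaddA : associative ofadd.
Proof.
elim/ofqW=> x; elim/ofqW=> y; elim/ofqW=> z.
by rewrite !ofaddE; apply/ofpi_eq/paddA.
Qed.
Lemma ofaddC : commutative ofadd.
Proof. elim/ofqW=> x; elim/ofqW=> y; rewrite !ofaddE; exact/ofpi_eq/paddC. Qed.
Lemma ofadd0 : left_id (ofpi (pzero D)) ofadd.
Proof. elim/ofqW=> x; rewrite !ofaddE; exact/ofpi_eq/padd0. Qed.
Lemma ofaddN : left_inverse (ofpi (pzero D)) ofopp ofadd.
Proof.
move=> a; rewrite -[X in ofadd _ X]ofpi_repr ofaddE; exact/ofpi_eq/paddN.
Qed.
HB.instance Definition _ :=
  GRing.isZmodule.Build ofq ofaddA ofaddC ofadd0 ofaddN.

Lemma ofmulA : associative ofmul.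
Proof.
elim/ofqW=> x; elim/ofqW=> y; elim/ofqW=> z.
by rewrite !ofmulE; apply/ofpi_eq/pmulA.
Qed.
Lemma ofmulC : commutative ofmul.
Proof. elim/ofqW=> x; elim/ofqW=> y; rewrite !ofmulE; exact/ofpi_eq/pmulC. Qed.
Lemma ofmul1 : left_id (ofpi (pone D)) ofmul.
Proof. elim/ofqW=> x; rewrite !ofmulE; exact/ofpi_eq/pmul1. Qed.
Lemma ofmulD : left_distributive ofmul +%R.
Proof.
elim/ofqW=> x; elim/ofqW=> y; elim/ofqW=> z.
by rewrite /GRing.add/= !(ofaddE,ofmulE); apply/ofpi_eq/pmulD.
Qed.
Lemma ofone_neq0 : ofpi (pone D) != 0.
Proof. by apply/eqP => /ofpi_eq; apply: pone_neq0. Qed.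
HB.instance Definition _ :=
  GRing.Zmodule_isComNzRing.Build ofq ofmulA ofmulC ofmul1 ofmulD ofone_neq0.

Lemma ofinv_ex (a : ofq) : exists b : ofq, a != 0 -> b * a = 1.
Proof.
have [->|] := eqVneq a 0; first by exists 0.
elim/ofqW: a => x x0.
have [|y yx] := @pinv_ex D x; first by move/ofpi_eq => xE; rewrite xE eqxx in x0.
by exists (ofpi y) => _; rewrite /GRing.mul/= ofmulE; apply/ofpi_eq.
Qed.
Definition ofinv (a : ofq) := if a == 0 then 0 else sval (cid (ofinv_ex a)).
Lemma ofmulV (a : ofq) : a != 0 -> ofinv a * a = 1.
Proof.
by move=> a0; rewrite /ofinv ifN //; case: cid => b /= ->.
Qed.
Lemma ofinv0 : ofinv 0 = 0. Proof. by rewrite /ofinv ifT. Qed.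
HB.instance Definition _ := GRing.ComNzRing_isField.Build ofq ofmulV ofinv0.

Definition ofle (a b : ofq) : bool := `[< ple (repr a : D) (repr b : D) >].
Lemma ofleE (x y : D) : ofle (ofpi x) (ofpi y) = `[< ple x y >].
Proof.
have [xx' x'x] := reprpi x; have [yy' y'y] := reprpi y.
apply/asboolP/asboolP => h.
  by apply: ple_trans yy'; apply: ple_trans h.
by apply: ple_trans y'y; apply: ple_trans h.
Qed.
Definition ofnorm (a : ofq) : ofq := if ofle 0 a then a else - a.

Lemma ofle0_add (a b : ofq) : ofle 0 a -> ofle 0 b -> ofle 0 (a + b).
Proof.
elim/ofqW: a => x; elim/ofqW: b => y; rewrite /GRing.add /= ofaddE !ofleE.
move=> /asboolP x0 /asboolP y0; apply/asboolP; apply: (ple_trans y0).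
by apply: (ple_trans (proj2 (padd0 y))); apply: ple_add.
Qed.
Lemma ofle0_mul (a b : ofq) : ofle 0 a -> ofle 0 b -> ofle 0 (a * b).
Proof.
elim/ofqW: a => x; elim/ofqW: b => y; rewrite /GRing.mul /= ofmulE !ofleE.
by move=> /asboolP x0 /asboolP y0; apply/asboolP; apply: ple_mul.
Qed.
Lemma ofle0_anti (a : ofq) : ofle 0 a -> ofle a 0 -> a = 0.
Proof.
elim/ofqW: a => x; rewrite !ofleE => /asboolP h /asboolP h'.
by apply/ofpi_eq; split.
Qed.
Lemma ofsub_ge0 (a b : ofq) : ofle 0 (b - a) = ofle a b.
Proof.
have H (x y : ofq) c : ofle x y -> ofle (x + c) (y + c).
  elim/ofqW: x => x; elim/ofqW: y => y; elim/ofqW: c => z.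
  rewrite /GRing.add /= !ofaddE !ofleE => /asboolP h.
  by apply/asboolP/ple_add.
by apply/idP/idP => /H; [move/(_ a); rewrite add0r subrK|move/(_ (-a)); rewrite subrr].
Qed.
Lemma ofle0_total (a : ofq) : ofle 0 a || ofle a 0.
Proof.
elim/ofqW: a => x; rewrite !ofleE; apply/orP.
by have [h|h] := ple_total (pzero D) x; [left|right]; apply/asboolP.
Qed.
Lemma ofnormN (a : ofq) : ofnorm (- a) = ofnorm a.
Proof.
rewrite /ofnorm opprK -sub0r ofsub_ge0.
case: ifPn => [h|h]; case: ifPn => [h'|h'] //; first by rewrite (ofle0_anti h' h) subrr.
by have := ofle0_total a; rewrite (negbTE h) (negbTE h').
Qed.
Lemma ofge0_norm (a : ofq) : ofle 0 a -> ofnorm a = a.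
Proof. by rewrite /ofnorm => ->. Qed.
HB.instance Definition _ := Num.IntegralDomain_isLeReal.Build ofq
  ofle0_add ofle0_mul ofle0_anti ofsub_ge0 ofle0_total ofnormN ofge0_norm
  (fun _ _ => erefl).

Definition offield : realFieldType := ofq.

Lemma preofieldP : exists (E : realFieldType) (pi : D -> E),
  [/\ forall e, exists x, pi x = e,
      pi (pzero D) = 0 /\ pi (pone D) = 1,
      forall x y, pi (padd x y) = pi x + pi y,
      forall x y, pi (pmul x y) = pi x * pi y
    & forall x y, ple x y <-> pi x <= pi y].
Proof.
exists offield, ofpi; split => //.
- by move=> e; exists (repr e); apply: ofpi_repr.
- by move=> x y; rewrite -ofaddE.
- by move=> x y; rewrite -ofmulE.
- move=> x y; rewrite -[_ <= _]/(ofle _ _) ofleE.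
  by split => [?|/asboolP //]; apply/asboolP.
Qed.

End OrderedFieldQuotient.

(** * Preorderings and homomorphisms into ordered fields *)

(** Zorn's lemma above a given set, with the chain condition only for nonempty
chains: a property such as containing all squares fails for the empty union. *)
Lemma zorn_above (U : Type) (P : set (set U)) (T : set U) : P T ->
  (forall F, F !=set0 -> F `<=` P -> total_on F subset ->
     P (\bigcup_(X in F) X)) ->
  exists M, [/\ P M, T `<=` M & forall B, P B -> M `<=` B -> B `<=` M].
Proof.
move=> PT chainP; have [] := @Zorn_bigcup U [set X | P (T `|` X)].
  move=> F FP Ftot /=; have [->|/set0P FN0] := eqVneq F set0.
    by rewrite bigcup_set0 setU0.
  have -> : T `|` \bigcup_(X in F) X
          = \bigcup_(X in [set T `|` X | X in F]) X.
    rewrite bigcup_image -bigcupUr //.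
  apply: chainP.
  - by have [X0 FX0] := FN0; exists (T `|` X0); exists X0.
  - by move=> _ [X FX <-]; apply: FP.
  - move=> _ _ [X FX <-] [Y FY <-].
    by have [h|h] := Ftot _ _ FX FY; [left|right]; apply: setUS.
move=> M [PM Mmax]; exists (T `|` M); split => //.
move=> B PB MB; have TMB : T `|` B = B.
  by apply/setUidr => x Tx; apply: MB; left.
have [sBM|nB] := pselect (B `<=` M); first by move=> x /sBM; right.
exfalso; apply: (Mmax B); last by rewrite /= TMB.
by split => // x Mx; apply: MB; right.
Qed.

Section Orderings.
Variable A : comNzRingType.

Definition preordering (T : set A) : Prop :=
  [/\ forall a b, T a -> T b -> T (a + b),
      forall a b, T a -> T b -> T (a * b)
    & forall a, T (a * a)].

Lemma preordering0 T : preordering T -> T 0.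
Proof. by move=> [_ _ /(_ 0)]; rewrite mul0r. Qed.

Lemma preordering1 T : preordering T -> T 1.
Proof. by move=> [_ _ /(_ 1)]; rewrite mul1r. Qed.

Definition adjoin (T : set A) (c : A) : set A :=
  [set x | exists a b, [/\ T a, T b & x = a + c * b]].

Lemma preordering_adjoin T c : preordering T -> preordering (adjoin T c).
Proof.
move=> pT; have [TD TM Tsq] := pT; split.
- move=> _ _ [a [b [Ta Tb ->]]] [a' [b' [Ta' Tb' ->]]].
  by exists (a + a'), (b + b'); split; [exact: (TD)|exact: (TD)|ring].
- move=> _ _ [a [b [Ta Tb ->]]] [a' [b' [Ta' Tb' ->]]].
  exists (a * a' + c * c * (b * b')), (a * b' + b * a'); split; last by ring.
    by apply: (TD); [exact: (TM)|apply: (TM) => //; exact: (TM)].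
  by apply: (TD); exact: (TM).
- by move=> a; exists (a * a), 0; split => //; [exact: preordering0|ring].
Qed.

Lemma adjoin_sub T c : preordering T -> T `<=` adjoin T c.
Proof. by move=> pT x Tx; exists x, 0; split => //; [exact: preordering0|ring]. Qed.

Lemma adjoin_mem T c : preordering T -> adjoin T c c.
Proof.
move=> pT; exists 0, 1; split; [exact: preordering0|exact: preordering1|ring].
Qed.

Definition prime_cone (M : set A) : Prop :=
  [/\ preordering M, ~ M (-1), forall a, M a \/ M (- a)
    & forall a b, M (a * b) -> M (- (a * b)) ->
        (M a /\ M (- a)) \/ (M b /\ M (- b))].

(** A preordering that is maximal among those without -1 is a prime cone.
If neither a nor -a belongs to it, then -1 = s + a t = s' - a t', and
multiplying (1 + s)(1 + s') = - a^2 t t' out puts -1 into the preordering.  If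
neither a nor b belongs to the support, then, up to signs, a t = 1 + s and
b t' = 1 + s', so that a b in the support again gives -1. *)
Lemma prime_cone_exists T : preordering T -> ~ T (-1) ->
  exists2 M, prime_cone M & T `<=` M.
Proof.
move=> pT T1.
have [] := @zorn_above A [set M | preordering M /\ ~ M (-1)] T (conj pT T1).
  move=> F [X0 FX0] FP Ftot; split; last by move=> [X FX]; apply: (FP X FX).2.
  split.
  - move=> a b [X FX Xa] [Y FY Yb].
    have [h|h] := Ftot _ _ FX FY.
      by exists Y => //; have [[YD _ _] _] := FP Y FY; apply: (YD) => //; exact: h.
    by exists X => //; have [[XD _ _] _] := FP X FX; apply: (XD) => //; exact: h.
  - move=> a b [X FX Xa] [Y FY Yb].
    have [h|h] := Ftot _ _ FX FY.
      by exists Y => //; have [[_ YM _] _] := FP Y FY; apply: (YM) => //; exact: h.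
    by exists X => //; have [[_ XM _] _] := FP X FX; apply: (XM) => //; exact: h.
  - by move=> a; exists X0 => //; have [[_ _ sq] _] := FP _ FX0; apply: sq.
move=> M [[pM M1] TM Mmax]; exists M => //; have [MD MM Msq] := pM.
have adj c : ~ M c -> exists a b, [/\ M a, M b & - 1 = a + c * b].
  move=> nMc; have [//|h] := pselect (adjoin M c (-1)).
  exfalso; apply: nMc.
  apply: (Mmax (adjoin M c)); last exact: adjoin_mem.
    by split => //; exact: preordering_adjoin.
  exact: adjoin_sub.
have tot a : M a \/ M (- a).
  apply: contrapT => /not_orP[/adj[s [t [Ms Mt E1]]] /adj[s' [t' [Ms' Mt' E2]]]].
  apply: M1.
  have -> : - 1 = s + s' + s * s' + a * a * (t * t') :> A.
    have e1 : a * t = - 1 - s by rewrite E1; ring.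
    have e2 : a * t' = 1 + s'.
      by rewrite -[LHS]opprK -mulNr -[1]opprK E2; ring.
    have -> : a * a * (t * t') = (a * t) * (a * t') by ring.
    by rewrite e1 e2; ring.
  by do ?apply: (MD) => //; do ?apply: (MM) => //; exact: Msq.
split => // a b Mab MNab.
apply: contrapT => /not_orP[na nb].
have key c : ~ (M c /\ M (- c)) -> exists t s, [/\ M t, M s,
     (c * t = 1 + s) \/ (- c * t = 1 + s) & True].
  move=> nc; have [Mc|Mc] := tot c.
    have /adj[s [t [Ms Mt E]]] : ~ M (- c) by move=> ?; apply: nc.
    by exists t, s; split=> //; left; rewrite -[1]opprK E; ring.
  have /adj[s [t [Ms Mt E]]] : ~ M c by move=> ?; apply: nc.
  by exists t, s; split=> //; right; rewrite -[1]opprK E; ring.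
have [t [s [Mt Ms E _]]] := key _ na; have [t' [s' [Mt' Ms' E' _]]] := key _ nb.
apply: M1.
have Mprod x : x = a * b * (t * t') \/ x = - (a * b * (t * t')) -> M x.
  move=> [] ->; first by apply: (MM) => //; exact: (MM).
  by rewrite -mulNr; apply: (MM) => //; exact: (MM).
set y := (1 + s) * (1 + s').
have My : M (- y).
  apply: Mprod; rewrite /y; case: E => <-; case: E' => <-.
  - by right; ring.
  - by left; ring.
  - by left; ring.
  - by right; ring.
have -> : -1 = - y + (s + s' + s * s') by rewrite /y; ring.
by do ?apply: (MD) => //; exact: (MM).
Qed.

Section FractionOrder.
Variable M : set A.
Hypothesis pM : prime_cone M.

Let pre : preordering M. Proof. by have [] := pM. Qed.
Let MD a b : M a -> M b -> M (a + b). Proof. by have [] := pre; auto. Qed.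
Let MM a b : M a -> M b -> M (a * b). Proof. by have [] := pre; auto. Qed.
Let Msq a : M (a * a). Proof. by have [] := pre. Qed.
Let M0 : M 0. Proof. exact: preordering0. Qed.
Let M1 : M 1. Proof. exact: preordering1. Qed.
Let MN1 : ~ M (-1). Proof. by case: pM. Qed.
Let Mtot a : M a \/ M (- a). Proof. by case: pM. Qed.

Definition supp a := M a /\ M (- a).

Let supp_prime a b : supp (a * b) -> supp a \/ supp b.
Proof. by case: pM => _ _ _ h []; apply: h. Qed.

Let suppM a b : supp a -> supp (a * b).
Proof.
move=> [Ma MNa]; have [Mb|Mb] := Mtot b; split.
- exact: (MM).
- by rewrite -mulNr; exact: (MM).
- by rewrite -mulrNN; exact: (MM).
- by rewrite -mulrN; exact: (MM).
Qed.

Let supp1 : ~ supp 1. Proof. by move=> [_]; have [_ nM1 _ _] := pM. Qed.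

Let Mcancel a c : ~ supp c -> M (a * (c * c)) -> M a.
Proof.
move=> nc Macc; have [//|MNa] := Mtot a.
have : supp (a * (c * c)) by split => //; rewrite -mulNr; exact: (MM).
by move=> /supp_prime[[]//|/supp_prime[]].
Qed.

Definition fracs := {x : A * A | ~ supp x.2}.
Definition mkfrac n d (h : ~ supp d) : fracs := exist _ (n, d) h.
Lemma supp_mul_neq d d' : ~ supp d -> ~ supp d' -> ~ supp (d * d').
Proof. by move=> h h' /supp_prime[]. Qed.

(** The difference n'/d' - n/d is multiplied by the square of d d', so that no
sign condition on the denominators is required. *)
Definition fle (x y : fracs) : Prop :=
  let: (n, d) := sval x in let: (n', d') := sval y in
  M ((n' * d - n * d') * (d * d')).
Definition fadd (x y : fracs) : fracs :=
  mkfrac ((sval x).1 * (sval y).2 + (sval y).1 * (sval x).2)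
    (supp_mul_neq (svalP x) (svalP y)).
Definition fmul (x y : fracs) : fracs :=
  mkfrac ((sval x).1 * (sval y).1) (supp_mul_neq (svalP x) (svalP y)).
Definition fopp (x : fracs) : fracs := mkfrac (- (sval x).1) (svalP x).

Let feq x y := fle x y /\ fle y x.

Let feqI x y : (sval y).1 * (sval x).2 = (sval x).1 * (sval y).2 -> feq x y.
Proof.
case: x => [[n d] dn]; case: y => [[n' d'] dn'] /= h; rewrite /feq /fle /= h.
by rewrite subrr !mul0r.
Qed.

Lemma fle_trans y x z : fle x y -> fle y z -> fle x z.
Proof.
case: x => [[n1 d1] h1]; case: y => [[n2 d2] h2]; case: z => [[n3 d3] h3].
rewrite /fle /= => a b; apply: (Mcancel h2).
have -> : (n3 * d1 - n1 * d3) * (d1 * d3) * (d2 * d2)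
  = (n2 * d1 - n1 * d2) * (d1 * d2) * (d3 * d3)
  + (n3 * d2 - n2 * d3) * (d2 * d3) * (d1 * d1) by ring.
by apply: (MD); apply: (MM).
Qed.

Lemma fle_total x y : fle x y \/ fle y x.
Proof.
case: x => [[n1 d1] h1]; case: y => [[n2 d2] h2]; rewrite /fle /=.
have -> : (n1 * d2 - n2 * d1) * (d2 * d1) = - ((n2 * d1 - n1 * d2) * (d1 * d2)).
  by ring.
exact: Mtot.
Qed.

Lemma fle_add x y z : fle x y -> fle (fadd x z) (fadd y z).
Proof.
case: x => [[n1 d1] h1]; case: y => [[n2 d2] h2]; case: z => [[n3 d3] h3].
rewrite /fle /= => h.
have -> : ((n2 * d3 + n3 * d2) * (d1 * d3) - (n1 * d3 + n3 * d1) * (d2 * d3)) *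
   (d1 * d3 * (d2 * d3))
  = (n2 * d1 - n1 * d2) * (d1 * d2) * ((d3 * d3) * (d3 * d3)) by ring.
by apply: (MM); rewrite //.
Qed.

Lemma fle_mul x y : fle (mkfrac 0 supp1) x -> fle (mkfrac 0 supp1) y ->
  fle (mkfrac 0 supp1) (fmul x y).
Proof.
case: x => [[n1 d1] h1]; case: y => [[n2 d2] h2].
rewrite /fle /= !mul0r !mulr1 !subr0 !mul1r => h h'.
by have := MM h h'; congr M; ring.
Qed.

Lemma fmul_congr x y z : feq x y -> feq (fmul x z) (fmul y z).
Proof.
case: x => [[n1 d1] h1]; case: y => [[n2 d2] h2]; case: z => [[n3 d3] h3].
rewrite /feq /fle /= => -[h h'].
have : supp ((n2 * d1 - n1 * d2) * (d1 * d2)).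
  by split => //; move: h'; congr M; ring.
move=> /(@suppM _ (n3 * d3 * (d3 * d3)))[a b].
by split; [move: a|move: b]; congr M; ring.
Qed.

Lemma fone_neq0 : ~ feq (mkfrac 1 supp1) (mkfrac 0 supp1).
Proof. by move=> [+ _]; rewrite /fle /= !mulr1 sub0r. Qed.

Lemma finv_ex x : ~ feq x (mkfrac 0 supp1) ->
  exists y, feq (fmul y x) (mkfrac 1 supp1).
Proof.
case: x => [[n d] h] x0; have nn : ~ supp n.
  move=> /(@suppM _ d)[a b]; apply: x0; rewrite /feq /fle /=.
  by split; [move: b|move: a]; congr M; ring.
by exists (mkfrac d nn); apply: feqI => /=; ring.
Qed.

Definition fracs_preofield : preofield.
refine (@PreOField fracs (mkfrac 0 supp1) (mkfrac 1 supp1) fadd fmul fopp fle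
  _ fle_trans fle_total fle_add fle_mul fmul_congr _ _ _ _ _ _ _ _
  fone_neq0 finv_ex).
- by move=> x; have [] : feq x x by exact: feqI.
- by move=> x y z; apply: feqI => /=; ring.
- by move=> x y; apply: feqI => /=; ring.
- by move=> x; apply: feqI => /=; ring.
- by move=> x; apply: feqI => /=; ring.
- by move=> x y z; apply: feqI => /=; ring.
- by move=> x y; apply: feqI => /=; ring.
- by move=> x; apply: feqI => /=; ring.
- by move=> x y z; apply: feqI => /=; ring.
Defined.

Lemma prime_cone_field : exists (E : realFieldType) (phi : {rmorphism A -> E}),
  forall a, M a <-> 0 <= phi a.
Proof.
have [E [pi [_ [pi0 pi1] piD piM piE]]] := preofieldP fracs_preofield.
pose f a := pi (mkfrac a supp1).
have pieq x y : feq x y -> pi x = pi y.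
  by move=> [/piE xy /piE yx]; apply/le_anti; rewrite xy yx.
have fD : {morph f : a b / a + b}.
  by move=> a b; rewrite /f -piD; apply: pieq; apply: feqI => /=; ring.
have fM : {morph f : a b / a * b}.
  by move=> a b; rewrite /f -piM; apply: pieq; apply: feqI => /=; ring.
have f0 : f 0 = 0 by exact: pi0.
have f1 : f 1 = 1 by exact: pi1.
pose fa := GRing.isNmodMorphism.Build A E f (conj f0 fD).
pose fm := GRing.isMonoidMorphism.Build A E f (conj f1 fM).
pose f' : {rmorphism A -> E} := HB.pack f fa fm.
exists E, f' => a; rewrite -f0.
rewrite -piE /= /fle /= mul0r subr0 !mulr1.
by split.
Qed.

End FractionOrder.

(** The form in which orderings are used: to show that -1 belongs to a
preordering, it suffices to refute all homomorphisms into ordered fields that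
are nonnegative on it. *)
Lemma preordering_field T : preordering T -> ~ T (-1) ->
  exists (E : realFieldType) (phi : {rmorphism A -> E}),
    forall a, T a -> 0 <= phi a.
Proof.
move=> pT T1; have [M pM TM] := prime_cone_exists pT T1.
have [E [phi phiE]] := prime_cone_field pM.
by exists E, phi => a Ta; apply/phiE/TM.
Qed.

End Orderings.

(** * Adjoining a root of a polynomial that changes sign *)

Section AdjoinRoot.
Variable E : realFieldType.
Implicit Types (p g h S : {poly E}).

(** Sums of squares weighted by nonnegative elements of E.  The weights matter:
nonnegative elements of an ordered field need not be sums of squares, and
the extension of the field must preserve its order. *)
Inductive wsos : {poly E} -> Prop :=
| wsos0 : wsos 0
| wsos_add c g S : 0 <= c -> wsos S -> wsos (c *: (g * g) + S).

Lemma wsosD S S' : wsos S -> wsos S' -> wsos (S + S').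
Proof.
move=> HS HS'; elim: HS => [|c g {}S c0 _ IH]; first by rewrite add0r.
by rewrite -addrA; exact: wsos_add.
Qed.

Lemma wsosM S S' : wsos S -> wsos S' -> wsos (S * S').
Proof.
move=> HS HS'; elim: HS => [|c g {}S c0 _ IH].
  by rewrite mul0r; exact: wsos0.
rewrite mulrDl; apply: wsosD => //.
elim: HS' => [|d k {IH}S' d0 _ IH]; first by rewrite mulr0; exact: wsos0.
rewrite mulrDr; apply: wsosD => //.
have -> : c *: (g * g) * (d *: (k * k)) = (c * d) *: ((g * k) * (g * k)) + 0.
  by rewrite -scalerAl -scalerAr scalerA addr0; congr (_ *: _); ring.
by apply: wsos_add; [exact: mulr_ge0|exact: wsos0].
Qed.

Lemma wsosZ c : 0 <= c -> wsos c%:P.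
Proof.
move=> c0; have -> : c%:P = c *: (1 * 1) + 0 :> {poly E}.
  by rewrite mulr1 addr0 -mul_polyC mulr1.
by apply: wsos_add => //; exact: wsos0.
Qed.

Lemma wsos_sqr g : wsos (g * g).
Proof. by rewrite -[g * g]scale1r -[1 *: _]addr0; apply: wsos_add ler01 wsos0. Qed.

Lemma wsos_horner S x : wsos S -> 0 <= S.[x].
Proof.
elim=> [|c g {}S c0 _ IH]; first by rewrite horner0.
by rewrite hornerD hornerZ hornerM addr_ge0 // mulr_ge0 // -expr2 sqr_ge0.
Qed.

Lemma wsos_mod p S : p != 0 -> wsos S ->
  exists S' h, [/\ wsos S', S = S' + p * h & (size S' <= (2 * size p).-1.-2)%N].
Proof.
move=> p0; elim=> [|c g {}S c0 _ [S' [h [HS' -> sS']]]].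
  by exists 0, 0; rewrite mulr0 addr0 size_poly0; split => //; exact: wsos0.
pose r : {poly E} := g %% p; pose q : {poly E} := g %/ p.
exists (c *: (r * r) + S'), (c *: (q * q * p + 2 * q * r) + h); split.
- exact: wsos_add.
- rewrite {1 2}(divp_eq g p) -/r -/q -!mul_polyC; ring.
- apply: (leq_trans (size_polyD _ _)); rewrite geq_max sS' andbT.
  apply: (leq_trans (size_scale_leq _ _)).
  apply: (leq_trans (size_polyMleq _ _)).
  have := ltn_modpN0 g p0; rewrite -/r => h1.
  by move: (size r) (size p) h1 => u v; lia.
Qed.

(** Artin and Schreier's descent.  Reducing the g_i modulo p, the identity
1 + sum c_i g_i^2 = p h has h of smaller degree than p.  The left-hand side
is positive everywhere, so h changes sign as p does, and the same identity,
read with h in the role of p, contradicts the induction hypothesis. *)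
Lemma sign_change_no_identity n p h S a b : (size p <= n)%N ->
  p.[a] < 0 -> 0 < p.[b] -> wsos S -> 1 + S = p * h -> False.
Proof.
elim: n p h S => [|n IH] p h S.
  by rewrite leqn0 size_poly_eq0 => /eqP ->; rewrite horner0 ltxx.
move=> sp pa pb HS E1.
have p0 : p != 0 by apply: contraTN pa => /eqP ->; rewrite horner0 ltxx.
have [S' [k [HS' ES sS']]] := wsos_mod p0 HS.
have sp2 : (1 < size p)%N.
  rewrite ltnNge; apply/negP => /size1_polyC E2.
  by move: pa pb; rewrite E2 !hornerC => /ltW; rewrite leNgt => /negP.
have E3 : 1 + S' = p * (h - k) by rewrite mulrBr -E1 ES; ring.
pose h' : {poly E} := h - k; rewrite -/h' in E3.
have pos x : 0 < p.[x] * h'.[x].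
  rewrite -hornerM -E3 hornerD hornerC.
  by have := wsos_horner x HS'; lra.
have h'0 : h' != 0.
  by apply: contraTneq (pos a) => ->; rewrite horner0 mulr0 ltxx.
apply: (IH h' p S') => //; last by rewrite mulrC.
- have : (size (p * h')%R <= maxn 1 (2 * size p).-1.-2)%N.
    rewrite -E3; apply: (leq_trans (size_polyD _ _)).
    by rewrite size_poly1 geq_max leq_maxl /= leq_max sS' orbT.
  rewrite size_mul //.
  have := size_poly_gt0 h'; rewrite h'0.
  by move: (size p) (size h') sp sp2 => u v; lia.
- by have := pos a; rewrite nmulr_rgt0.
- by have := pos b; rewrite pmulr_rgt0.
Qed.

Definition root_cone p : set {poly E} :=
  [set q | exists S h, wsos S /\ q = S + p * h].

Lemma root_cone_preordering p : preordering (root_cone p).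
Proof.
split.
- move=> _ _ [S [h [HS ->]]] [S' [h' [HS' ->]]].
  by exists (S + S'), (h + h'); split; [exact: wsosD|ring].
- move=> _ _ [S [h [HS ->]]] [S' [h' [HS' ->]]].
  exists (S * S'), (S * h' + S' * h + p * h * h').
  by split; [exact: wsosM|ring].
- by move=> g; exists (g * g), 0; split; [exact: wsos_sqr|ring].
Qed.

(** By [sign_change_no_identity] the cone of p does not contain -1, and an
ordering containing it sends both p and -p to nonnegative elements, so that the
class of X is a root of p. *)
Lemma adjoin_root p a b : p.[a] < 0 -> 0 < p.[b] ->
  exists (E' : realFieldType) (i : {rmorphism E -> E'}) (x : E'),
    {homo i : c / 0 <= c} /\ (map_poly i p).[x] = 0.
Proof.
move=> pa pb.
have [|E' [phi phiP]] := preordering_field (root_cone_preordering p).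
  move=> [S [h [HS E1]]].
  apply: (@sign_change_no_identity (size p) p (- h) S a b) => //.
  have -> : S = - 1 - p * h by rewrite E1; ring.
  ring.
exists E', (phi \o polyC), (phi 'X); split.
  move=> c c0; apply: phiP; exists c%:P, 0; split; last by ring.
  exact: wsosZ.
have -> : (map_poly (phi \o polyC) p).[phi 'X] = phi p.
  rewrite map_poly_comp /= horner_map /=; congr (phi _).
  by rewrite -[RHS]comp_polyXr.
apply/le_anti/andP; split; last first.
  by apply: phiP; exists 0, 1; split; [exact: wsos0|ring].
rewrite -oppr_ge0 -rmorphN; apply: phiP.
by exists 0, (-1); split; [exact: wsos0|ring].
Qed.

End AdjoinRoot.

(** * The real closure of an ordered field *)

Lemma rmorph_ge0_sgz (E E' : realFieldType) (i : {rmorphism E -> E'}) :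
  {homo i : c / 0 <= c} -> forall c, sgz (i c) = sgz c.
Proof.
move=> i0 c; case: (sgzP c) => [->|c0|c0]; first by rewrite rmorph0 sgz0.
  by rewrite gtr0_sgz // lt_neqAle i0 ?ltW // eq_sym fmorph_eq0 gt_eqF.
rewrite ltr0_sgz // -oppr_gt0 -rmorphN lt_neqAle i0 ?oppr_ge0 ?ltW //.
by rewrite eq_sym fmorph_eq0 oppr_eq0 lt_eqF.
Qed.

Lemma rmorph_ge0_lt0 (E E' : realFieldType) (i : {rmorphism E -> E'}) :
  {homo i : c / 0 <= c} -> forall c, (i c < 0) = (c < 0).
Proof. by move=> i0 c; rewrite -!sgz_cp0 rmorph_ge0_sgz. Qed.

Lemma rmorph_ge0_gt0 (E E' : realFieldType) (i : {rmorphism E -> E'}) :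
  {homo i : c / 0 <= c} -> forall c, (0 < i c) = (0 < c).
Proof. by move=> i0 c; rewrite -!sgz_cp0 rmorph_ge0_sgz. Qed.

Section RealClosure.
Variable E : realFieldType.

(** Names for the elements of a real closure.  [Root n s a b] stands for a root
of the polynomial with coefficients s 0, ..., s (n - 1) if it changes sign from
a to b.  Since names exist before any extension is built, extensions that
realize different finite sets of them can be compared in an ultraproduct. *)
Inductive term :=
| Cst of E | Add of term & term | Mul of term & term | Opp of term
| Inv of term | Root (n : nat) (s : nat -> term) (a b : term).

HB.instance Definition _ := gen_eqMixin term.

Fixpoint depth (t : term) : nat :=
  match t with
  | Cst _ => 0
  | Add s t | Mul s t => (maxn (depth s) (depth t)).+1
  | Opp s | Inv s => (depth s).+1
  | Root n s a b => (maxn (\max_(k < n) depth (s k)) (maxn (depth a) (depth b))).+1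
  end.

Section Evaluation.
Variables (E' : realFieldType) (i : {rmorphism E -> E'}) (rt : term -> E').

Fixpoint ev (t : term) : E' :=
  match t with
  | Cst c => i c
  | Add s t => ev s + ev t
  | Mul s t => ev s * ev t
  | Opp s => - ev s
  | Inv s => (ev s)^-1
  | Root _ _ _ _ => rt t
  end.

Definition good (t : term) : Prop :=
  match t with
  | Root n s a b => let p := \poly_(k < n) ev (s k) in
      p.[ev a] < 0 -> 0 < p.[ev b] -> p.[rt t] = 0
  | _ => True
  end.

End Evaluation.

(** Assigning a value to a root t after passing to an extension leaves the value
of every other term of at most the same depth unchanged, since t does not occur
in it. *)
Lemma ev_ext (E' E'' : realFieldType) (i : {rmorphism E -> E'})
    (j : {rmorphism E' -> E''}) rt t x u :
  (depth u <= depth t)%N -> u <> t ->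
  ev (j \o i) (fun u => if u == t then x else j (rt u)) u = j (ev i rt u).
Proof.
have neq v w : (depth v < depth w)%N -> v <> w by move=> /[swap] ->; rewrite ltnn.
elim: u => [c|u IHu v IHv|u IHu v IHv|u IHu|u IHu|n s _ a _ b _] //=.
- by rewrite gtn_max => /andP[du dv] _; rewrite IHu ?IHv ?rmorphD //;
    [exact: ltnW|exact: neq|exact: ltnW|exact: neq].
- by rewrite gtn_max => /andP[du dv] _; rewrite IHu ?IHv ?rmorphM //;
    [exact: ltnW|exact: neq|exact: ltnW|exact: neq].
- by move=> du _; rewrite IHu ?rmorphN //; [exact: ltnW|exact: neq].
- by move=> du _; rewrite IHu ?fmorphV //; [exact: ltnW|exact: neq].
- by move=> _ /eqP/negPf ->.
Qed.

(** Roots are adjoined in the order of increasing depth, so that the coefficients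
of each polynomial have received their final values when its root is
adjoined. *)
Lemma good_exists (l : seq term) :
  exists (E' : realFieldType) (i : {rmorphism E -> E'}) (rt : term -> E'),
    {homo i : c / 0 <= c} /\ {in l, forall t, good i rt t}.
Proof.
pose r (s t : term) := (depth t <= depth s)%N.
have rtr : transitive r by move=> y x z; rewrite /r => xy yz; exact: leq_trans xy.
suff H l' : sorted r l' -> exists (E' : realFieldType)
    (i : {rmorphism E -> E'}) (rt : term -> E'),
    {homo i : c / 0 <= c} /\ {in l', forall t, good i rt t}.
  have [|E' [i [rt [i0 gd]]]] := H (sort r l).
    by apply: sort_sorted => s t; rewrite /r; exact: leq_total.
  by exists E', i, rt; split => // t tl; apply: gd; rewrite mem_sort.
elim: l' => [_|t l' IH /= st].
  by exists E, idfun, (fun _ => 0); split => // c.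
have /IH[E' [i [rt [i0 gd]]]] := path_sorted st.
have dl : {in l', forall u, (depth u <= depth t)%N}.
  by have /allP := order_path_min rtr st.
have [tl|tl] := boolP (t \in l').
  by exists E', i, rt; split => // u; rewrite inE => /orP[/eqP->|]; exact: gd.
suff [E'' [j [x [j0 gt]]]] : exists (E'' : realFieldType)
    (j : {rmorphism E' -> E''}) (x : E''), {homo j : c / 0 <= c} /\
    good (j \o i) (fun u => if u == t then x else j (rt u)) t.
  exists E'', (j \o i), (fun u => if u == t then x else j (rt u)).
  split; first by move=> c /i0/j0.
  move=> u; rewrite inE => /orP[/eqP -> //|ul].
  have ut : u <> t by move=> ut; rewrite -ut ul in tl.
  have := gd u ul; have := dl u ul; case: u ul ut => // n s a b ul ut du.
  have sub w : (depth w < depth (Root n s a b))%N ->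
      ev (j \o i) (fun u => if u == t then x else j (rt u)) w = j (ev i rt w).
    move=> dw; apply: ev_ext; first exact: leq_trans (ltnW dw) du.
    by move=> E1; move: (leq_trans dw du); rewrite E1 ltnn.
  have ps : \poly_(k < n) ev (j \o i)
      (fun u => if u == t then x else j (rt u)) (s k)
      = map_poly j (\poly_(k < n) ev i rt (s k)).
    apply/polyP => k; rewrite coef_map !coef_poly; case: ifP => [kn|_].
      by rewrite sub //= ltnS leq_max (leq_bigmax (Ordinal kn)).
    by rewrite /= rmorph0.
  rewrite /= ps !sub ?horner_map /=; last 2 first.
  - by rewrite ltnS !leq_max leqnn !orbT.
  - by rewrite ltnS !leq_max leqnn !orbT.
  rewrite rmorph_ge0_lt0 // rmorph_ge0_gt0 // => h pa pb.
  by move/eqP/negPf: ut => ->; rewrite horner_map h // rmorph0.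
case: t {IH st} dl tl => [c|u v|u v|u|u|n s a b] dl tl;
  try by exists E', idfun, 0; split => // e.
set p := \poly_(k < n) ev i rt (s k).
have [[pa pb]|npab] := pselect (p.[ev i rt a] < 0 /\ 0 < p.[ev i rt b]);
  last first.
  exists E', idfun, (rt (Root n s a b)); split; first by move=> e.
  have -> : (fun u => if u == Root n s a b then rt (Root n s a b)
                      else idfun (rt u)) = rt.
    by apply/funext => u; case: eqP => [->|].
  by move=> pa pb; exfalso; apply: npab.
have [E'' [j [x [j0 rx]]]] := adjoin_root pa pb.
exists E'', j, x; split => //=; set t := Root n s a b; rewrite eqxx => _ _.
rewrite -rx; congr (_.[_]); apply/polyP => k.
rewrite coef_map !coef_poly; case: ifP => [kn|_]; last by rewrite /= rmorph0.
have dk : (depth (s k) < depth t)%N by rewrite ltnS leq_max (leq_bigmax (Ordinal kn)).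
rewrite ev_ext //; first exact: ltnW.
by move=> E1; rewrite E1 ltnn in dk.
Qed.

Record model := Model {
  mfield : realFieldType;
  membed : {rmorphism E -> mfield};
  mroot : term -> mfield
}.

Lemma model_exists (l : seq term) : exists m : model,
  {homo membed m : c / 0 <= c} /\
  {in l, forall t, good (membed m) (@mroot m) t}.
Proof.
have [E' [i [rt H]]] := good_exists l.
by exists (Model i rt).
Qed.

Definition model_at (l : seq term) : model := sval (cid (model_exists l)).
Definition eval_at l (t : term) : mfield (model_at l) := ev (membed (model_at l)) (@mroot (model_at l)) t.
Arguments eval_at : simpl never.
Lemma model_at_embed l : {homo membed (model_at l) : c / 0 <= c}.
Proof. by rewrite /model_at; case: cid => m []. Qed.
Lemma model_at_good l : {in l, forall t, good (membed (model_at l)) (@mroot (model_at l)) t}.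
Proof. by rewrite /model_at; case: cid => m []. Qed.

(** The filter of tails for the inclusion of finite sets of terms: in the
ultraproduct every given term is good in almost all factors. *)
Definition above : set_system (seq term) :=
  [set P | exists l : seq term, forall l' : seq term, {subset l <= l'} -> P l'].

Lemma above_proper : ProperFilter above.
Proof.
split; first by move=> [l /(_ l)]; apply.
split; first by exists [::].
- move=> P Q [l lP] [l' lQ]; exists (l ++ l') => m ml; split.
    by apply: lP => t tl; apply: ml; rewrite mem_cat tl.
  by apply: lQ => t tl; apply: ml; rewrite mem_cat tl orbT.
- by move=> P Q PQ [l lP]; exists l => m /lP/PQ.
Qed.

Section Ultraproduct.
Variable U : set_system (seq term).
Hypothesis UU : UltraFilter U.
Hypothesis aU : above `<=` U.

Let UP : ProperFilter U. Proof. exact: ultra_proper. Qed.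

Definition tle (s t : term) : Prop := U [set l | eval_at l s <= eval_at l t].

Let UT (P : seq term -> Prop) : (forall l, P l) -> U P.
Proof. by move=> PT; apply: filterS (filterT (F := U)) => l _. Qed.

Let US (P Q : set (seq term)) : U P -> (forall l, P l -> Q l) -> U Q.
Proof. by move=> UP' PQ; apply: filterS UP'. Qed.

Let teqI s t : (forall l, eval_at l s = eval_at l t) -> tle s t /\ tle t s.
Proof. by move=> H; split; apply: UT => l /=; rewrite H. Qed.

Let ev0 l : eval_at l (Cst 0) = 0. Proof. exact: rmorph0. Qed.
Let ev1 l : eval_at l (Cst 1) = 1. Proof. exact: rmorph1. Qed.

Lemma tltP s t : ~ tle t s <-> U [set l | eval_at l s < eval_at l t].
Proof.
split => [nst|ust].
  have [//|] := in_ultra_setVsetC [set l | eval_at l t <= eval_at l s] UU.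
  by apply: filterS => l /= /negP; rewrite -ltNge.
move=> uts; apply: (@filter_not_empty _ U).
by apply: filterS (filterI ust uts) => l [/= h]; rewrite leNgt h.
Qed.

Definition terms_preofield : preofield.
refine (@PreOField term (Cst 0) (Cst 1) Add Mul Opp tle
  _ _ _ _ _ _ _ _ _ _ _ _ _ _ _ _).
- by move=> x; apply: UT => l /=.
- move=> y x z; rewrite /tle => xy yz.
  by apply: filterS2 xy yz => l /=; exact: le_trans.
- move=> x y; have [?|/tltP h] := pselect (tle x y); first by left.
  by right; apply: (US h) => l /=; exact: ltW.
- by move=> x y z xy; apply: (US xy) => l /=; rewrite /eval_at /= lerD2r.
- move=> x y; rewrite /tle => x0 y0; apply: filterS2 x0 y0 => l /=.
  by rewrite ev0; exact: mulr_ge0.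
- move=> x y z [xy yx].
  have h : U ([set l | eval_at l x <= eval_at l y] `&` [set l | eval_at l y <= eval_at l x]).
    exact: filterI.
  have {}h : U [set l | eval_at l x = eval_at l y].
    by apply: (US h) => l /= [h1 h2]; apply/le_anti/andP.
  by split; apply: (US h) => l; rewrite /eval_at /= => ->.
- by move=> x y z; apply: teqI => l; rewrite /eval_at /= addrA.
- by move=> x y; apply: teqI => l; rewrite /eval_at /= addrC.
- by move=> x; apply: teqI => l; rewrite /eval_at /= rmorph0 add0r.
- by move=> x; apply: teqI => l; rewrite /eval_at /= rmorph0 addNr.
- by move=> x y z; apply: teqI => l; rewrite /eval_at /= mulrA.
- by move=> x y; apply: teqI => l; rewrite /eval_at /= mulrC.
- by move=> x; apply: teqI => l; rewrite /eval_at /= rmorph1 mul1r.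
- by move=> x y z; apply: teqI => l; rewrite /eval_at /= mulrDl.
- move=> [/[swap] _]; apply: (proj2 (tltP _ _)); apply: UT => l /=.
  by rewrite ev0 ev1 ltr01.
- move=> x x0; exists (Inv x).
  have h : U [set l | eval_at l x != 0].
    have [//|h] := in_ultra_setVsetC [set l | eval_at l x != 0] UU.
    exfalso; apply: x0; split; apply: (US h) => l /= /negP.
      by rewrite negbK ev0 => /eqP ->.
    by rewrite negbK ev0 => /eqP ->.
  by split; apply: (US h) => l /= l0; rewrite ev1 /eval_at /= mulVf.
Defined.

Fixpoint tpow (t : term) n := if n is n'.+1 then Mul t (tpow t n') else Cst 1.
Fixpoint thorner n (s : nat -> term) (a : term) :=
  if n is n'.+1 then Add (thorner n' s a) (Mul (s n') (tpow a n')) else Cst 0.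

Lemma eval_at_horner l n s a :
  eval_at l (thorner n s a) = (\poly_(k < n) eval_at l (s k)).[eval_at l a].
Proof.
have pow m : eval_at l (tpow a m) = eval_at l a ^+ m.
  elim: m => [|m IH]; first by rewrite ev1 expr0.
  by rewrite exprS -IH.
rewrite horner_poly; elim: n => [|n IH]; first by rewrite big_ord0 ev0.
by rewrite big_ord_recr /= -IH -pow.
Qed.

(** Sign changes with roots anywhere; [sign_change_ivt] recovers their
location. *)
Lemma sign_change_closure : exists (F : realFieldType) (j : {rmorphism E -> F}),
  {homo j : c / 0 <= c} /\
  forall (p : {poly F}) a b, p.[a] < 0 -> 0 < p.[b] -> exists x, p.[x] = 0.
Proof.
have [F [pi [surj [pi0 pi1] piD piM piE]]] := preofieldP terms_preofield.
pose f c := pi (Cst c).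
have pieq x y : (forall l, eval_at l x = eval_at l y) -> pi x = pi y.
  by move=> /teqI[/piE xy /piE yx]; apply/le_anti; rewrite xy yx.
have fD : {morph f : a b / a + b}.
  by move=> a b; rewrite /f -piD; apply: pieq => l; rewrite /eval_at /= rmorphD.
have fM : {morph f : a b / a * b}.
  by move=> a b; rewrite /f -piM; apply: pieq => l; rewrite /eval_at /= rmorphM.
pose fa := GRing.isNmodMorphism.Build E F f (conj pi0 fD).
pose fm := GRing.isMonoidMorphism.Build E F f (conj pi1 fM).
pose f' : {rmorphism E -> F} := HB.pack f fa fm.
exists F, f'; split.
  move=> c c0; rewrite -pi0 -[f' c]/(pi (Cst c)); apply/piE/UT => l /=.
  by rewrite ev0; exact: model_at_embed.
move=> p a b.
have [ta <-] := surj a; have [tb <-] := surj b.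
pose n := size p; pose s k := sval (cid (surj p`_k)).
have sE k : pi (s k) = p`_k by rewrite /s; case: cid.
have hornerE t : pi (thorner n s t) = p.[pi t].
  have pow m : pi (tpow t m) = pi t ^+ m.
    by elim: m => [|m IH]; [exact: pi1|rewrite exprS -IH -piM].
  rewrite horner_coef -/n; elim: n => [|m IH]; first by rewrite big_ord0 -pi0.
  by rewrite big_ord_recr /= -IH -pow -sE -piM -piD.
have ltE t t' : pi t < pi t' -> U [set l | eval_at l t < eval_at l t'].
  by rewrite ltNge => /negP h; apply/tltP => /piE.
rewrite -!hornerE -pi0 => /ltE pa /ltE pb.
pose t := Root n s ta tb; exists (pi t); rewrite -hornerE.
suff h : U [set l | eval_at l (thorner n s t) = 0].
  apply/le_anti/andP; split; apply/piE; rewrite /= /tle.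
    by apply: (US h) => l /= ->; rewrite ev0.
  by apply: (US h) => l /= ->; rewrite ev0.
have Ut : U [set l : seq term | t \in l].
  by apply: aU; exists [:: t] => l; apply; rewrite inE.
apply: (US (filterI (filterI pa pb) Ut)) => l /= [[]].
rewrite !ev0 !eval_at_horner => h1 h2 /model_at_good h3; exact: h3.
Qed.

End Ultraproduct.

(** To find a root between a and b, substitute
y(u) = (a (1 - u^2)^2 + 4 b u^2) / (1 + u^2)^2, which maps the whole line into
[a, b] with y(0) = a and y(1) = b.  Clearing denominators gives a polynomial
that changes sign between 0 and 1, and any root u of it, wherever it lies, has
y(u) in [a, b]. *)
Lemma sign_change_ivt (F : realFieldType) :
  (forall (p : {poly F}) a b, p.[a] < 0 -> 0 < p.[b] -> exists x, p.[x] = 0) ->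
  Num.real_closed_axiom F.
Proof.
move=> H p a b ab /andP[pa pb].
have [pa0|pa0] := eqVneq p.[a] 0.
  by exists a; [rewrite lexx ab|rewrite rootE pa0].
have [pb0|pb0] := eqVneq p.[b] 0.
  by exists b; [rewrite lexx ab|rewrite rootE pb0].
have {pa pa0}pa : p.[a] < 0 by rewrite lt_neqAle pa0.
have {pb pb0}pb : 0 < p.[b] by rewrite lt_neqAle eq_sym pb0.
pose n := size p.
pose A : {poly F} := a *: (1 - 'X^2) ^+ 2 + (4 * b) *: 'X^2.
pose B : {poly F} := (1 + 'X^2) ^+ 2.
pose P : {poly F} := \sum_(k < n) p`_k *: (A ^+ k * B ^+ (n - k)).
have Bpos u : 0 < B.[u].
  rewrite /B horner_exp hornerD hornerXn hornerC exprn_gt0 //.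
  by have := sqr_ge0 u; lra.
have PE u : P.[u] = B.[u] ^+ n * p.[A.[u] / B.[u]].
  rewrite /P horner_sum (horner_coef p) -/n mulr_sumr; apply: eq_bigr => k _.
  rewrite hornerZ hornerM (horner_exp A) (horner_exp B) [RHS]mulrCA; congr (_ * _).
  rewrite expr_div_n [RHS]mulrCA; congr (_ * _).
  have Bk : B.[u] ^+ k != 0 by rewrite expf_neq0 // gt_eqF.
  by apply: (canRL (mulfK Bk)); rewrite -exprD subnK // ltnW.
have AE u : A.[u] = a * (1 - u ^+ 2) ^+ 2 + 4 * b * u ^+ 2.
  by rewrite /A !(hornerE, hornerXn, horner_exp).
have BE u : B.[u] = (1 + u ^+ 2) ^+ 2.
  by rewrite /B !(hornerE, hornerXn, horner_exp).
have P0 : P.[0] < 0.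
  by rewrite PE AE BE expr0n /= subr0 addr0 !expr1n mulr1 mulr0 addr0 mul1r divr1.
have P1 : 0 < P.[1].
  rewrite PE AE BE expr1n subrr expr0n /= mulr0 add0r mulr1.
  have -> : 4 * b / (1 + 1) ^+ 2 = b by field.
  by rewrite mulr_gt0 // exprn_gt0 // exprn_gt0 // ltr_wpDl.
have [u] := H _ _ _ P0 P1.
rewrite PE => /eqP; rewrite mulf_eq0 gt_eqF ?exprn_gt0 //= => pu.
exists (A.[u] / B.[u]) => //.
rewrite ler_pdivlMr // ler_pdivrMr // AE BE.
have h1 : 0 <= u ^+ 2 by exact: sqr_ge0.
have h2 : 0 <= (1 - u ^+ 2) ^+ 2 by exact: sqr_ge0.
apply/andP; split; rewrite -subr_ge0.
  have -> : a * (1 - u ^+ 2) ^+ 2 + 4 * b * u ^+ 2 - a * (1 + u ^+ 2) ^+ 2 =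
    (b - a) * (4 * u ^+ 2) by ring.
  by rewrite mulr_ge0 // ?subr_ge0 // mulr_ge0.
have -> : b * (1 + u ^+ 2) ^+ 2 - (a * (1 - u ^+ 2) ^+ 2 + 4 * b * u ^+ 2) =
    (b - a) * (1 - u ^+ 2) ^+ 2 by ring.
by rewrite mulr_ge0 // subr_ge0.
Qed.

Lemma real_closure : exists (F : rcfType) (j : {rmorphism E -> F}),
  {homo j : c / 0 <= c}.
Proof.
have [U [UU aU]] := ultraFilterLemma above_proper.
have [F [j [j0 /sign_change_ivt ivt]]] := sign_change_closure UU aU.
pose rF := Num.RealField_isClosed.Build F ivt.
pose F' : rcfType := HB.pack (Num.RealField.sort F) rF.
by exists F', j.
Qed.

End RealClosure.

(** * Transfer of sign conditions and the Artin-Lang theorem *)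

Section CauchyIndex.
Variable F : rcfType.
Implicit Types P Q S : {poly F}.

Lemma sgz_sqr (c : F) : c != 0 -> sgz c * sgz c = 1.
Proof. by move=> c0; rewrite -sgzM gtr0_sgz // -expr2 exprn_even_gt0. Qed.

(** The jumps of S / Q depend only on S modulo Q. *)
Lemma jump_addM P Q S x : (size S < size Q)%N ->
  jump (P * Q + S) Q x = jump S Q x.
Proof.
move=> sSQ; set X := P * Q + S.
rewrite jump_mod; set k := Pdiv.Ring.rscalp X Q.
have Q0 : Q != 0 by rewrite -size_poly_gt0; apply: leq_ltn_trans sSQ.
have lcQ0 : lead_coef Q ^+ k != 0 by rewrite expf_neq0 // lead_coef_eq0.
have -> : Pdiv.Ring.rmodp X Q = lead_coef Q ^+ k *: S.
  have := Pdiv.ComRing.rdivp_eq Q X; rewrite -/k.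
  set D := Pdiv.Ring.rdivp _ _; set T := Pdiv.Ring.rmodp _ _ => E1.
  have sT : (size T < size Q)%N by exact: Pdiv.Ring.ltn_rmodpN0.
  have E2 : T - lead_coef Q ^+ k *: S = (lead_coef Q ^+ k *: P - D) * Q.
    rewrite mulrBl -scalerAl; apply/eqP; rewrite subr_eq addrAC -scalerDr -/X E1.
    by rewrite [D * Q + T]addrC addrK.
  apply/eqP; rewrite -subr_eq0 E2; apply: contraT => n0.
  have : (size (T - lead_coef Q ^+ k *: S)%R < size Q)%N.
    apply: leq_ltn_trans (size_polyD _ _) _; rewrite gtn_max sT size_polyN.
    exact: leq_ltn_trans (size_scale_leq _ _) sSQ.
  rewrite E2 size_mul //; last by apply: contraNneq n0 => ->; rewrite mul0r.
  have : (0 < size (lead_coef Q ^+ k *: P - D)%R)%N.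
    by rewrite size_poly_gt0; apply: contraNneq n0 => ->; rewrite mul0r.
  by move: (size _) (size Q) => u v; lia.
rewrite jump_mulCp mulrA sgzX -exprMn sgz_sqr ?expr1n ?mul1r //.
by rewrite lead_coef_eq0.
Qed.

Lemma cindexR_pseudo_div (c : F) P Q D S : c != 0 -> (size S < size Q)%N ->
  c *: P = D * Q + S -> cindexR P Q = sgz c * cindexR S Q.
Proof.
move=> c0 sSQ E1; rewrite /cindexR mulr_sumr; apply: eq_bigr => x _.
by rewrite -(jump_addM D x sSQ) -E1 jump_mulCp mulrA sgz_sqr ?mul1r.
Qed.

(** Reciprocity for Cauchy indices: with [cindexR_pseudo_div] it gives the
Euclidean recursion, and reducing P modulo Q by any pseudo-division suffices. *)
Lemma cindexR_inv P Q : cindexR Q P = crossR (P * Q) - cindexR P Q.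
Proof.
rewrite cindexR_rec; congr (_ + _); rewrite /cindexR -sumrN.
apply: eq_bigr => x _; rewrite [in RHS]jump_mod /next_mod jump_mulCp sgzN sgzX.
by rewrite mulNr.
Qed.

End CauchyIndex.

Definition agree (A : eqType) (F R : realDomainType) (phi : A -> F)
  (psi : A -> R) (C : seq A) : Prop := {in C, forall c, sgz (phi c) = sgz (psi c)}.

Lemma agree_cat (A : eqType) (F R : realDomainType) (phi : A -> F)
    (psi : A -> R) (C C' : seq A) :
  agree phi psi (C ++ C') <-> agree phi psi C /\ agree phi psi C'.
Proof.
split=> [H|[H H'] c]; last by rewrite mem_cat => /orP[/H|/H'].
by split=> c cC; apply: H; rewrite mem_cat cC ?orbT.
Qed.

Lemma size_map_poly_le (A B : nzSemiRingType) (f : A -> B) (p : {poly A}) :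
  (size (map_poly f p) <= size p)%N.
Proof. exact: size_poly. Qed.

Section Transfer.
Variables (A : comNzRingType) (F : rcfType) (phi : {rmorphism A -> F}).
Implicit Types p q : {poly A}.

Lemma agree_coef (R : rcfType) (psi : {rmorphism A -> R}) p :
  agree phi psi (polyseq p) -> forall i, sgz (phi p`_i) = sgz (psi p`_i).
Proof.
move=> H i; have [ip|ip] := ltnP i (size p); last first.
  by rewrite nth_default // !rmorph0 !sgz0.
by apply: H; exact: mem_nth.
Qed.

Lemma agree_size (R : rcfType) (psi : {rmorphism A -> R}) p :
  agree phi psi (polyseq p) ->
  size (map_poly psi p) = size (map_poly phi p) /\
  sgz (lead_coef (map_poly phi p)) = sgz (lead_coef (map_poly psi p)).
Proof.
move=> /agree_coef H.
have z i : (map_poly phi p)`_i = 0 <-> (map_poly psi p)`_i = 0.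
  rewrite !coef_map; split => /eqP; rewrite -sgz_eq0.
    by rewrite H sgz_eq0 => /eqP.
  by rewrite -H sgz_eq0 => /eqP.
have sz : size (map_poly psi p) = size (map_poly phi p).
  apply/eqP; rewrite eqn_leq; apply/andP; split; apply/leq_sizeP => j hj.
    by apply/z; move: j hj; apply/leq_sizeP.
  by apply/z; move: j hj; apply/leq_sizeP.
by split => //; rewrite /lead_coef sz !coef_map; exact: H.
Qed.

Lemma crossR_transfer (R : rcfType) (psi : {rmorphism A -> R}) p :
  agree phi psi (polyseq p) ->
  crossR (map_poly phi p) = crossR (map_poly psi p).
Proof.
move=> /agree_size[sz lc]; rewrite /crossR /qe_rcf_th.variation.
rewrite -[in RHS]sgz_lt0 -[in LHS]sgz_lt0 !sgzM /sgp_minfty /sgp_pinfty !sgz_sgr !sgzM !sgzX !sgzN.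
by rewrite !sgz1 lc sz.
Qed.

(** phi may kill leading coefficients of p, in which case pseudo-division by p
does not commute with phi.  The truncation has the same image as p and a leading
coefficient that survives; so it does for every psi whose signs agree with
those of phi on the coefficients of p. *)
Definition trunc p : {poly A} := \poly_(i < size (map_poly phi p)) p`_i.

Lemma trunc_map p : map_poly phi (trunc p) = map_poly phi p.
Proof.
apply/polyP => i; rewrite !coef_map coef_poly; case: ltnP => //= ip.
by rewrite rmorph0 -coef_map nth_default.
Qed.

Lemma size_trunc p : size (trunc p) = size (map_poly phi p).
Proof.
apply/eqP; rewrite eqn_leq size_poly /=.
by have := size_map_poly_le phi (trunc p); rewrite trunc_map.
Qed.

Lemma trunc_agree (R : rcfType) (psi : {rmorphism A -> R}) p :
  agree phi psi (polyseq p) -> map_poly psi (trunc p) = map_poly psi p.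
Proof.
move=> H; have [sz _] := agree_size H.
apply/polyP => i; rewrite !coef_map coef_poly; case: ltnP => //= ip.
by rewrite rmorph0 -coef_map nth_default // sz.
Qed.

(** The finite set C depends on p, q and phi but on neither psi nor its target:
it consists of the coefficients that occur in the pseudo-remainder sequence
computed over A.  As phi is fixed, all case distinctions on vanishing leading
coefficients are already decided. *)
Lemma cindexR_transfer p q : exists C, forall (R : rcfType)
  (psi : {rmorphism A -> R}), agree phi psi C ->
  cindexR (map_poly phi q) (map_poly phi p)
  = cindexR (map_poly psi q) (map_poly psi p).
Proof.
have [n] := ubnP (size q); elim: n p q => // n IH p q; rewrite ltnS => sq.
have [q0|q0] := eqVneq (map_poly phi q) 0.
  exists (polyseq q) => R psi /trunc_agree <-.
  rewrite q0 cindexR0p (_ : trunc q = 0) ?rmorph0 ?cindexR0p //.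
  by apply/eqP; rewrite -size_poly_eq0 size_trunc q0 size_poly0.
set q' := trunc q; set r := Pdiv.Ring.rmodp p q'.
set k := Pdiv.Ring.rscalp p q'.
have q'0 : q' != 0 by rewrite -size_poly_gt0 size_trunc size_poly_gt0.
have sr : (size r < size q')%N by exact: Pdiv.Ring.ltn_rmodpN0.
have [|C HC] := IH q' r.
  apply: (leq_trans sr); rewrite size_trunc.
  exact: leq_trans (size_map_poly_le _ _) sq.
exists (polyseq q ++ (polyseq (p * q) ++ (polyseq q' ++ C))) => R psi.
move=> /agree_cat[aq /agree_cat[apq /agree_cat[aq' aC]]].
rewrite [LHS]cindexR_inv [RHS]cindexR_inv -!rmorphM (crossR_transfer apq); congr (_ - _).
have [sq' lq'] := agree_size aq'.
have lcphi : phi (lead_coef q') != 0.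
  rewrite /lead_coef -coef_map trunc_map size_trunc -/(lead_coef _).
  by rewrite lead_coef_eq0.
have szphi : size (map_poly phi q') = size q' by rewrite trunc_map size_trunc.
have lcE : phi (lead_coef q') = lead_coef (map_poly phi q').
  by rewrite /lead_coef coef_map szphi.
have lcE' : psi (lead_coef q') = lead_coef (map_poly psi q').
  by rewrite /lead_coef coef_map sq' szphi.
have eq := Pdiv.ComRing.rdivp_eq q' p; rewrite -/k -/r in eq.
have Ephi : (phi (lead_coef q')) ^+ k *: map_poly phi p
   = map_poly phi (Pdiv.Ring.rdivp p q') * map_poly phi q' + map_poly phi r.
  by have := congr1 (map_poly phi) eq; rewrite map_polyZ rmorphD rmorphM rmorphXn.
have Epsi : (psi (lead_coef q')) ^+ k *: map_poly psi p
   = map_poly psi (Pdiv.Ring.rdivp p q') * map_poly psi q' + map_poly psi r.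
  by have := congr1 (map_poly psi) eq; rewrite map_polyZ rmorphD rmorphM rmorphXn.
have szr : (size (map_poly phi r) < size (map_poly phi q'))%N.
  by rewrite szphi; exact: leq_ltn_trans (size_map_poly_le _ _) sr.
have szr' : (size (map_poly psi r) < size (map_poly psi q'))%N.
  by rewrite sq' szphi; exact: leq_ltn_trans (size_map_poly_le _ _) sr.
have lcpsi : psi (lead_coef q') != 0.
  by rewrite lcE' -sgz_eq0 -lq' -lcE sgz_eq0.
rewrite -(trunc_agree aq) -(trunc_map q) -/q'.
rewrite (cindexR_pseudo_div (expf_neq0 k lcphi) szr Ephi).
rewrite (cindexR_pseudo_div (expf_neq0 k lcpsi) szr' Epsi).
by rewrite (HC R psi aC) !sgzX lcE lcE' lq'.
Qed.

Lemma taqR_transfer p q : exists C, forall (R : rcfType)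
  (psi : {rmorphism A -> R}), agree phi psi C ->
  taqR (map_poly phi p) (map_poly phi q)
  = taqR (map_poly psi p) (map_poly psi q).
Proof.
have [C HC] := cindexR_transfer p (p^`() * q).
exists C => R psi aC; rewrite /taqR !changes_mods_cindex !deriv_map -!rmorphM.
exact: HC.
Qed.

(** A Tarski query of g restricted by the conditions q > 0; for g = 1 it counts
the points that satisfy them. *)
Definition ptaq (G : rcfType) (z : seq G) (sq : seq {poly G}) (g : {poly G}) :
  int := \sum_(x <- z | all (fun q : {poly _} => 0 < q.[x]) sq) sgz g.[x].

(** The indicator of q > 0 is (sgn (q^2) + sgn q) / 2, which reduces restricted
queries to unrestricted ones. *)
Lemma ptaq_cons (G : rcfType) (z : seq G) (q : {poly G}) sq (g : {poly G}) :
  2 * ptaq z (q :: sq) g = ptaq z sq (g * (q * q)) + ptaq z sq (g * q).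
Proof.
rewrite /ptaq mulr_sumr -big_split /= big_mkcond [RHS]big_mkcond /=.
apply: eq_bigr => x _; case: (all _ sq); rewrite ?andbF ?andbT //.
by rewrite !hornerM !sgzM -sgz_gt0; case: (sgzP q.[x]) => _ /=; ring.
Qed.

Lemma ptaq_transfer p (sq : seq {poly A}) (g : {poly A}) : exists C,
  forall (R : rcfType) (psi : {rmorphism A -> R}), agree phi psi C ->
  ptaq (rootsR (map_poly phi p)) (map (map_poly phi) sq) (map_poly phi g)
  = ptaq (rootsR (map_poly psi p)) (map (map_poly psi) sq) (map_poly psi g).
Proof.
elim: sq g => [|q sq IH] g.
  have [C HC] := taqR_transfer p g; exists C => R psi /HC.
  by rewrite -!taq_taqR.
have [C HC] := IH (g * (q * q)); have [C' HC'] := IH (g * q).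
exists (C ++ C') => R psi /agree_cat[aC aC'].
have two : injective ( *%R (2 : int)) by exact: mulfI.
by apply: two; rewrite /= !ptaq_cons -!rmorphM (HC _ _ aC) (HC' _ _ aC').
Qed.

Lemma ptaq1_gt0 (G : rcfType) (P : {poly G}) (sq : seq {poly G}) : P != 0 ->
  (0 < ptaq (rootsR P) sq 1) <->
  exists2 x, P.[x] = 0 & all (fun q : {poly _} => 0 < q.[x]) sq.
Proof.
move=> P0; rewrite /ptaq.
under eq_bigr do rewrite hornerC sgz1.
split => [h|[x Px xsq]]; last first.
  rewrite (big_rem x) /=; last by rewrite -roots_on_rootsR // rootE Px eqxx.
  by rewrite xsq; apply: ltr_wpDr => //; exact: sumr_ge0.
have [/hasP[x xP xsq]|/hasPn h0] :=
    boolP (has (fun x => all (fun q : {poly _} => 0 < q.[x]) sq) (rootsR P)).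
  exists x => //; move: xP; rewrite -roots_on_rootsR // => /andP[_].
  exact: rootP.
move: h; rewrite big_seq_cond big1 ?ltxx // => x /andP[/h0/negP].
by move=> + ?.
Qed.

(** An open condition is met near -oo, near +oo, or at a critical point of the
product of the polynomials; the first two cases depend on leading coefficients,
the last one on a count of roots of the derivative. *)
Lemma pos_transfer (sq : seq {poly A}) (y : F) :
  all (fun q : {poly A} => 0 < (map_poly phi q).[y]) sq ->
  exists C, forall (R : rcfType) (psi : {rmorphism A -> R}), agree phi psi C ->
  exists y', all (fun q : {poly A} => 0 < (map_poly psi q).[y']) sq.
Proof.
move=> ysq.
have bigE (G : rcfType) (f : {rmorphism A -> G}) x :
   all (fun q : {poly A} => 0 < (map_poly f q).[x]) sq =
   \big[andb/true]_(q <- map (map_poly f) sq) (0 < q.[x]).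
  by rewrite big_map big_all.
have [_ /(_ (ex_intro _ y _))] := bounding_polyP (map (map_poly phi) sq).
rewrite -bigE => /(_ ysq) bnd.
have lead_transfer e : exists C, forall (R : rcfType)
    (psi : {rmorphism A -> R}), agree phi psi C ->
    \big[andb/true]_(q <- map (map_poly phi) sq) (0 < (-1) ^+ (e * (size q).-1) * lead_coef q) ->
    \big[andb/true]_(q <- map (map_poly psi) sq) (0 < (-1) ^+ (e * (size q).-1) * lead_coef q).
  exists (flatten (map (@polyseq A) sq)) => R psi aC.
  rewrite !big_map !big_all => /allP h; apply/allP => q qsq.
  have aq : agree phi psi (polyseq q).
    by move=> c cq; apply: aC; apply/flatten_mapP; exists q.
  have [sz lc] := agree_size aq; have := h q qsq.
  by rewrite -!sgz_cp0 !sgzM lc sz !sgzX !sgzN !sgz1.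
have e0 (G : rcfType) (l : seq {poly G}) :
    \big[andb/true]_(q <- l) (0 < lead_coef q)
    = \big[andb/true]_(q <- l) (0 < (-1) ^+ (0 * (size q).-1) * lead_coef q).
  by apply: eq_bigr => q _; rewrite mul0n mul1r.
have e1 (G : rcfType) (l : seq {poly G}) :
    \big[andb/true]_(q <- l) (0 < (-1) ^+ (size q).-1 * lead_coef q)
    = \big[andb/true]_(q <- l) (0 < (-1) ^+ (1 * (size q).-1) * lead_coef q).
  by apply: eq_bigr => q _; rewrite mul1n.
have [C0 HC0] := lead_transfer 0%N; have [C1 HC1] := lead_transfer 1%N.
pose b : {poly A} := (\prod_(q <- sq) q)^`().
have bE (G : rcfType) (f : {rmorphism A -> G}) :
    bounding_poly (map (map_poly f) sq) = map_poly f b.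
  by rewrite /bounding_poly big_map /b -deriv_map rmorph_prod.
have [C2 HC2] := ptaq_transfer b sq 1.
exists (C0 ++ (C1 ++ (C2 ++ polyseq b))) => R psi.
move=> /agree_cat[a0 /agree_cat[a1 /agree_cat[a2 ab]]].
suff : exists x, \big[andb/true]_(q <- map (map_poly psi) sq) (0 < q.[x]).
  by move=> [x]; rewrite -bigE => ?; exists x.
apply/bounding_polyP; case: bnd => [h|h|].
- by apply: Or31; rewrite e0; apply: HC0 => //; rewrite -e0.
- by apply: Or32; rewrite e1; apply: HC1 => //; rewrite -e1.
move=> [x /andP[]]; rewrite bE -bigE => /eqP bx xsq.
have [b0|b0] := eqVneq (map_poly phi b) 0.
  (* the product of the polynomials is constant, hence so is each of them *)
  have qE (q : {poly F}) : q \in map (map_poly phi) sq -> 0 < q.[y].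
    by move=> /mapP[q0 q0s ->]; exact: (allP ysq).
  pose P : {poly F} := \prod_(q <- map (map_poly phi) sq) q.
  have P0 : P != 0.
    rewrite prodf_seq_neq0; apply/allP => q /qE; apply: contraTneq => ->.
    by rewrite horner0 ltxx.
  have dP : P^`() = 0 by rewrite -b0 -bE.
  have : size P == 1%N.
    have := size_deriv P; rewrite dP size_poly0; rewrite -size_poly_gt0 in P0.
    by move: (size P) P0 => [|[|]].
  move=> /size_prod_eq1 const; apply: Or31; rewrite e0; apply: HC0 => //.
  rewrite -e0 big_all; apply/allP => q qs; have := qE q qs.
  have /eqP/size_poly1P[c c0 ->] := const q qs.
  by rewrite hornerC lead_coefC.
have : 0 < ptaq (rootsR (map_poly phi b)) (map (map_poly phi) sq) (map_poly phi 1).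
  by rewrite rmorph1; apply/ptaq1_gt0 => //; exists x => //; rewrite all_map.
rewrite (HC2 R psi a2) rmorph1.
have [sb _] := agree_size ab.
case/ptaq1_gt0 => [|x' bx' x'sq]; first by rewrite -size_poly_eq0 sb size_poly_eq0.
apply: Or33; exists x'; rewrite bE bx' eqxx -bigE; move: x'sq.
by rewrite all_map.
Qed.

(** After a change of sign all strict conditions read q > 0, and the equations
combine into the single equation sum l^2 = 0, which is not identically zero
unless all equations are.  The coefficients of L belong to C to account for the
polynomials killed by phi. *)
Lemma sign_transfer (L : seq {poly A}) (y : F) : exists C,
  forall (R : rcfType) (psi : {rmorphism A -> R}), agree phi psi C ->
  exists y', {in L, forall l,
    sgz (map_poly phi l).[y] = sgz (map_poly psi l).[y']}.
Proof.
pose s l := (map_poly phi l).[y].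
pose flip l : {poly A} := if 0 < s l then l else - l.
pose sq := map flip [seq l <- L | s l != 0].
pose Z := [seq l <- L | (s l == 0) && (map_poly phi l != 0)].
have flip_sgz (G : rcfType) (f : {rmorphism A -> G}) l x : s l != 0 ->
    0 < (map_poly f (flip l)).[x] -> sgz (map_poly f l).[x] = sgz (s l).
  rewrite /flip; case: (sgzP (s l)) => //= sl _; first by move=> h; rewrite gtr0_sgz.
  by rewrite rmorphN hornerN oppr_gt0 => h; rewrite ltr0_sgz.
have sq_pos : all (fun q : {poly A} => 0 < (map_poly phi q).[y]) sq.
  rewrite all_map all_filter; apply/allP => l _; apply/implyP => /= sl.
  rewrite /flip; case: (sgzP (s l)) sl => //; rewrite /s ?eqxx // => h _.
  by rewrite rmorphN hornerN oppr_gt0.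
pose p : {poly A} := \sum_(l <- Z) l * l.
have pE (G : rcfType) (f : {rmorphism A -> G}) x :
    (map_poly f p).[x] = 0 <-> {in Z, forall l, (map_poly f l).[x] = 0}.
  rewrite rmorph_sum horner_sum /=.
  under eq_bigr do rewrite rmorphM hornerM -expr2.
  split=> [/eqP|H]; last by rewrite big_seq big1 // => l /H ->; rewrite expr0n.
  rewrite psumr_eq0 => [/allP H l lZ|l _]; last exact: sqr_ge0.
  by have := H l lZ; rewrite sqrf_eq0 => /eqP.
have [C0 HC0] : exists C0, forall (R : rcfType) (psi : {rmorphism A -> R}),
    agree phi psi C0 -> exists y', all (fun q : {poly A} => 0 < (map_poly psi q).[y']) sq
      /\ {in Z, forall l, (map_poly psi l).[y'] = 0}.
  case EZ : Z => [|l0 Z'].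
    have [C HC] := pos_transfer sq_pos; exists C => R psi /HC[y' ?].
    by exists y'.
  rewrite -EZ; have l0Z : l0 \in Z by rewrite EZ inE eqxx.
  have p0 : map_poly phi p != 0.
    move: (l0Z); rewrite mem_filter => /andP[/andP[_ l00] _].
    set c := cauchy_bound (map_poly phi l0).
    apply/eqP => p0; have /pE/(_ _ l0Z)/eqP : (map_poly phi p).[c] = 0.
      by rewrite p0 horner0.
    by apply/negP/(ge_cauchy_bound l00); rewrite in_itv /= lexx.
  have [C HC] := ptaq_transfer p sq 1.
  exists (C ++ polyseq p) => R psi /agree_cat[aC ap].
  have [sp _] := agree_size ap.
  have : 0 < ptaq (rootsR (map_poly phi p)) (map (map_poly phi) sq) (map_poly phi 1).
    rewrite rmorph1; apply/ptaq1_gt0 => //; exists y; last by rewrite all_map.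
    by apply/pE => l; rewrite mem_filter => /andP[/andP[/eqP]].
  rewrite (HC R psi aC) rmorph1 => /ptaq1_gt0[|y' py' y'sq].
    by rewrite -size_poly_eq0 sp size_poly_eq0.
  exists y'; split; last exact/pE.
  by move: y'sq; rewrite all_map.
exists (C0 ++ flatten (map (@polyseq A) L)) => R psi /agree_cat[a0 aL].
have [y' [ysq yZ]] := HC0 R psi a0; exists y' => l lL.
have [sl|sl] := eqVneq (s l) 0; last first.
  rewrite (flip_sgz _ psi l y') //; move/allP: ysq; apply.
  by apply: map_f; rewrite mem_filter sl.
rewrite -/(s l) sl sgz0; have [pl|pl] := eqVneq (map_poly phi l) 0; last first.
  by rewrite yZ ?sgz0 // mem_filter sl eqxx pl.
have al : agree phi psi (polyseq l).
  by move=> c cl; apply: aL; apply/flatten_mapP; exists l.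
have [sz _] := agree_size al.
have -> : map_poly psi l = 0 by apply/eqP; rewrite -size_poly_eq0 sz pl size_poly0.
by rewrite horner0 sgz0.
Qed.

End Transfer.

Section ArtinLang.
Variable K : rcfType.

(** The signs that finitely many elements of A take under a homomorphism to a real
closed field are also taken at a K-point of A. *)
Definition specializable (A : comNzRingType) (iota : {rmorphism K -> A}) : Prop :=
  forall (F : rcfType) (phi : {rmorphism A -> F}) (C : seq A),
  exists psi : {rmorphism A -> K}, psi \o iota =1 id /\ agree phi psi C.

Lemma specializable_base : specializable (idfun : {rmorphism K -> K}).
Proof.
move=> F phi C; exists idfun; split => // c _; apply: rmorph_ge0_sgz => {}c c0.
by rewrite -(sqr_sqrtr c0) rmorphXn; exact: sqr_ge0.
Qed.

Lemma specializable_poly (A : comNzRingType) (iota : {rmorphism K -> A}) :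
  specializable iota -> specializable (polyC \o iota : {rmorphism K -> {poly A}}).
Proof.
move=> spA F phi L.
pose phi0 : {rmorphism A -> F} := phi \o polyC.
have phiE l : phi l = (map_poly phi0 l).[phi 'X].
  rewrite map_poly_comp /= horner_map /=; congr (phi _).
  by rewrite -[LHS]comp_polyXr.
have [C HC] := sign_transfer phi0 L (phi 'X).
have [psi0 [psi0K /HC[y' Hy']]] := spA F phi0 C.
have cpsi : commr_rmorph psi0 y' by move=> c; exact: mulrC.
exists (horner_morph cpsi); split.
  by move=> c; exact: etrans (horner_morphC cpsi _) (psi0K c).
by move=> l lL; rewrite phiE Hy'.
Qed.

(** An iterated polynomial ring, known only through its universal property,
stands in for multivariate polynomials: elimination treats one variable at a
time and needs no isomorphism between the two. *)
Lemma specializable_tower n : exists (A : comNzRingType)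
  (iota : {rmorphism K -> A}) (X : 'I_n -> A), specializable iota /\
  forall (F : rcfType) (j : {rmorphism K -> F}) (xi : 'I_n -> F),
    exists phi : {rmorphism A -> F}, phi \o iota =1 j /\ forall i, phi (X i) = xi i.
Proof.
elim: n => [|n [A [iota [X [spA univ]]]]].
  exists K, idfun, (fun=> 0); split; first exact: specializable_base.
  by move=> F j xi; exists j; split => // -[].
exists {poly A}, (polyC \o iota), (fun i => if unlift ord0 i is Some k then (X k)%:P else 'X).
split; first exact: specializable_poly.
move=> F j xi; have [phi [phij phiX]] := univ F j (fun k => xi (lift ord0 k)).
have cphi : commr_rmorph phi (xi ord0) by move=> c; exact: mulrC.
exists (horner_morph cphi); split.
  by move=> c; exact: etrans (horner_morphC cphi _) (phij c).
move=> i; case: unliftP => [k ->|->].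
  exact: etrans (horner_morphC cphi _) (phiX k).
exact: horner_morphX.
Qed.

Lemma rmorph_mmap n (A B : comNzRingType) (f : {rmorphism K -> A})
    (g : {rmorphism A -> B}) (h : 'I_n -> A) (p : {mpoly K[n]}) :
  g (mmap f h p) = mmap (g \o f) (g \o h) p.
Proof.
rewrite /mmap rmorph_sum; apply: eq_bigr => m _; rewrite rmorphM /=.
congr (_ * _); rewrite /mmap1 rmorph_prod; apply: eq_bigr => i _.
exact: rmorphXn.
Qed.

Lemma mmap_rmorph n (B : comNzRingType) (g : {rmorphism {mpoly K[n]} -> B}) p :
  g p = mmap (g \o mpolyC n (R:=K)) (fun i => g (mpolyX K (mnm1 i))) p.
Proof.
rewrite {1}[p]mpolyE rmorph_sum /mmap; apply: eq_bigr => m _.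
rewrite -mul_mpolyC rmorphM; congr (_ * _).
rewrite mpolyXE_id rmorph_prod; apply: eq_bigr => i _; exact: rmorphXn.
Qed.

Lemma eq_mmap n (A B : comNzRingType) (f f' : A -> B) (h h' : 'I_n -> B) p :
  f =1 f' -> h =1 h' -> mmap f h p = mmap f' h' p.
Proof.
move=> ff hh; apply: eq_bigr => m _; rewrite ff; congr (_ * _).
by apply: eq_bigr => i _; rewrite hh.
Qed.

(** Evaluation at the images of the variables factors phi through a specializable
ring. *)
Theorem artin_lang n (E : realFieldType) (phi : {rmorphism {mpoly K[n]} -> E})
    (C : seq {mpoly K[n]}) :
  exists x : 'I_n -> K, {in C, forall p, sgz (phi p) = sgz p.@[x]}.
Proof.
have [F [j j0]] := real_closure E.
have [A [iota [X [spA univ]]]] := specializable_tower n.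
pose pi : {rmorphism {mpoly K[n]} -> F} := j \o phi.
have [phi' [phi'iota phi'X]] :=
  univ F (pi \o @mpolyC n K) (fun i => pi (mpolyX K (mnm1 i))).
pose theta p := mmap iota X p.
have [psi [psiK Hpsi]] := spA F phi' (map theta C).
exists (psi \o X) => p pC.
have -> : p.@[psi \o X] = psi (theta p).
  by rewrite rmorph_mmap; apply: eq_mmap => [c|//]; exact: esym (psiK c).
rewrite -Hpsi ?map_f // rmorph_mmap.
rewrite -(rmorph_ge0_sgz j0) -[j (phi p)]/(pi p) mmap_rmorph.
congr sgz; apply: eq_mmap => [c|i]; first exact: esym (phi'iota c).
exact: esym (phi'X i).
Qed.

End ArtinLang.

(** * Semirings, bounded elements and the Archimedean property of preorderings *)

Section SemiringTheory.
Context {R : realType} {A : comAlgType R}.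
Implicit Types (S T G : set A) (a b c : A).

Section Closure.
Variable S : set A.
Hypothesis semS : is_semiring S.

Lemma semiringD a b : S a -> S b -> S (a + b).
Proof. by have [[_ h _] _ _] := semS; exact: h. Qed.
Lemma semiringM a b : S a -> S b -> S (a * b).
Proof. by have [_ _ h] := semS; exact: h. Qed.
Lemma semiringZ (k : R) a : 0 <= k -> S a -> S (k *: a).
Proof. by have [[_ _ h] _ _] := semS; exact: h. Qed.
Lemma semiring1 : S 1. Proof. by have [] := semS. Qed.
Lemma semiringC (k : R) : 0 <= k -> S k%:A.
Proof. by move=> k0; apply: semiringZ => //; exact: semiring1. Qed.
Lemma semiring0 : S 0.
Proof. by rewrite -(scale0r 1); exact: semiringC. Qed.
Lemma semiring_sum (I : Type) (r : seq I) (P : pred I) (F : I -> A) :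
  (forall i, P i -> S (F i)) -> S (\sum_(i <- r | P i) F i).
Proof. by move=> SF; elim/big_ind: _ => //; [exact: semiring0|exact: semiringD]. Qed.
Definition bounded_elt a := exists2 k : R, 0 < k & S (k *: 1 - a) /\ S (k *: 1 + a).

Lemma bounded_eltC (k : R) : bounded_elt k%:A.
Proof.
exists (`|k| + 1); first by rewrite ltr_wpDl.
rewrite -scalerBl -scalerDl; split; apply: semiringC.
  by have := ler_norm k; lra.
by have := ler_norm (- k); rewrite normrN; lra.
Qed.

Lemma bounded_eltD a b : bounded_elt a -> bounded_elt b -> bounded_elt (a + b).
Proof.
move=> [k k0 [ka ka']] [l l0 [lb lb']]; exists (k + l); first exact: addr_gt0.
rewrite scalerDl; split.
  by rewrite opprD addrACA; exact: semiringD.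
by rewrite addrACA; exact: semiringD.
Qed.

Lemma halfD (x : A) : (2^-1 : R) *: (x + x) = x.
Proof.
by rewrite scalerDr -scalerDl (_ : _ + _ = 1) ?scale1r //; field.
Qed.

(** k l - a b = ((k - a)(l + b) + (k + a)(l - b)) / 2, and the same with b
replaced by -b. *)
Lemma bounded_eltM a b : bounded_elt a -> bounded_elt b -> bounded_elt (a * b).
Proof.
move=> [k k0 [ka ka']] [l l0 [lb lb']]; exists (k * l); first exact: mulr_gt0.
have -> : (k * l) *: (1 : A) = (k *: 1) * (l *: 1).
  by rewrite -[RHS]scalerAl mul1r scalerA.
move: (k *: 1) (l *: 1) ka ka' lb lb' => K L ka ka' lb lb'.
split.
  have -> : K * L - a * b =
      (2^-1 : R) *: ((K - a) * (L + b) + (K + a) * (L - b)).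
    by rewrite -[LHS]halfD; congr (_ *: _); ring.
  by apply: semiringZ; [rewrite invr_ge0|apply: semiringD; exact: semiringM].
have -> : K * L + a * b =
    (2^-1 : R) *: ((K - a) * (L - b) + (K + a) * (L + b)).
  by rewrite -[LHS]halfD; congr (_ *: _); ring.
by apply: semiringZ; [rewrite invr_ge0|apply: semiringD; exact: semiringM].
Qed.

End Closure.

Lemma semiring_gen_semiring G : is_semiring (semiring_gen G).
Proof.
split.
- split.
  + exists 0 => T [semT _]; exact: semiring0.
  + by move=> a b Ga Gb T [semT GT]; apply: semiringD => //; [apply: Ga|apply: Gb].
  + by move=> k a k0 Ga T [semT GT]; apply: semiringZ => //; apply: Ga.
- by move=> T [semT _]; exact: semiring1.
- by move=> a b Ga Gb T [semT GT]; apply: semiringM => //; [apply: Ga|apply: Gb].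
Qed.

Lemma sub_semiring_gen G : G `<=` semiring_gen G.
Proof. by move=> a Ga T [_ GT]; exact: GT. Qed.

Lemma semiring_gen_min G T : is_semiring T -> G `<=` T -> semiring_gen G `<=` T.
Proof. by move=> semT GT a; apply. Qed.

Lemma semiring_gen_mono G G' : G `<=` G' -> semiring_gen G `<=` semiring_gen G'.
Proof.
move=> GG; apply: semiring_gen_min; first exact: semiring_gen_semiring.
by move=> a /GG; exact: sub_semiring_gen.
Qed.

(** Elements obtained from finitely many squares already form a semiring; this is
why finitely many p_j suffice. *)
Lemma semiring_gen_finite_squares G a :
  semiring_gen (G `|` range (fun p : A => p ^+ 2)) a ->
  exists ps : seq A, semiring_gen (G `|` [set p ^+ 2 | p in [set` ps]]) a.
Proof.
pose W (ps : seq A) := semiring_gen (G `|` [set p ^+ 2 | p in [set` ps]]).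
have Wmono (ps ps' : seq A) : {subset ps <= ps'} -> W ps `<=` W ps'.
  move=> ss; apply: semiring_gen_mono => x [Gx|[p pps <-]]; [by left|right].
  by exists p => //=; exact: ss.
have Wcat ps ps' b c : W ps b -> W ps' c -> W (ps ++ ps') b /\ W (ps ++ ps') c.
  move=> Wb Wc; split; first by apply: Wmono Wb => x; rewrite mem_cat => ->.
  by apply: Wmono Wc => x; rewrite mem_cat orbC => ->.
have Wsem ps : is_semiring (W ps) by exact: semiring_gen_semiring.
apply: (@semiring_gen_min _ [set a | exists ps, W ps a]).
  split.
  - split.
    + by exists 0, [::]; exact: (semiring0 (Wsem _)).
    + move=> b c [ps Wb] [ps' Wc]; exists (ps ++ ps').
      have [Wb' Wc'] := Wcat _ _ _ _ Wb Wc; exact: (semiringD (Wsem _)).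
    + by move=> k b k0 [ps Wb]; exists ps; exact: (semiringZ (Wsem _)).
  - by exists [::]; exact: (semiring1 (Wsem _)).
  - move=> b c [ps Wb] [ps' Wc]; exists (ps ++ ps').
    have [Wb' Wc'] := Wcat _ _ _ _ Wb Wc; exact: (semiringM (Wsem _)).
move=> b [Gb|[p _ <-]]; first by exists [::]; apply: sub_semiring_gen; left.
exists [:: p]; apply: sub_semiring_gen; right; exists p => //=.
by rewrite inE.
Qed.

Section Woermann.
Variable T : set A.
Hypothesis semT : is_semiring T.
Hypothesis sqT : forall a, T (a ^+ 2).

Lemma semiring_preordering : preordering T.
Proof.
by split; [exact: semiringD|exact: semiringM|move=> a; rewrite -expr2].
Qed.

Lemma semiring_adjoin c : is_semiring (adjoin T c).
Proof.
have pT := preordering_adjoin c semiring_preordering; have [TD TM _] := pT.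
split => //; last exact: preordering1.
split => //; first by exists 0; exact: preordering0.
move=> k _ k0 [a [b [Ta Tb ->]]]; exists (k *: a), (k *: b).
by split; [exact: semiringZ|exact: semiringZ|rewrite scalerDr scalerAr].
Qed.

(** Completing the square: k + 1/4 - x = (k - x^2) + (1/2 - x)^2, and likewise
for -x. *)
Lemma bounded_of_sum_squares (I : finType) (x : I -> A) (k : R) :
  T (k *: 1 - \sum_i x i ^+ 2) -> forall i, bounded_elt T (x i).
Proof.
move=> Tk i; exists (`|k| + 4^-1); first by rewrite ltr_wpDl.
have Tki : T ((`|k|) *: 1 - x i ^+ 2).
  have -> : `|k| *: 1 - x i ^+ 2 = (`|k| - k) *: 1 + ((k *: 1 - \sum_i x i ^+ 2)
      + \sum_(j | j != i) x j ^+ 2).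
    by rewrite [in RHS](bigD1 i) //= scalerBl; ring.
  apply: semiringD => //.
    by apply: semiringC => //; rewrite subr_ge0 ler_norm.
  by apply: semiringD => //; apply: semiring_sum.
have quarter : (4^-1 : R) *: 1 = ((2^-1 : R) *: 1) ^+ 2 :> A.
  by rewrite exprZn expr1n; congr (_ *: _); field.
have half : (2^-1 : R) *: 1 + (2^-1 : R) *: 1 = 1 :> A.
  by rewrite -scalerDr halfD.
rewrite scalerDl quarter; move: ((2^-1 : R) *: 1 : A) half => h half; split.
  have -> : `|k| *: 1 + h ^+ 2 - x i = (`|k| *: 1 - x i ^+ 2) + (h - x i) ^+ 2.
    by rewrite -[x i in LHS]mul1r -half; ring.
  exact: semiringD.
have -> : `|k| *: 1 + h ^+ 2 + x i = (`|k| *: 1 - x i ^+ 2) + (h + x i) ^+ 2.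
  by rewrite -[x i in LHS]mul1r -half; ring.
exact: semiringD.
Qed.

(** Write N for the sum of squares, so that g = rho - N.  From g s = 1 + t,
both g (1 + t) = g^2 s and (1 + t)(T + g T) lie in T.  As t is bounded by k with
respect to T + g T, (1 + t)(k - t) is in T, and adding (t - k/2)^2 gives
m - t in T for m = k + k^2/4.  Finally
rho (1 + m) - N = g (1 + t) + rho (m - t) + t N. *)
Lemma woermann (I : finType) (x : I -> A) (rho : R) s t : 0 <= rho ->
  let g := rho *: 1 - \sum_i x i ^+ 2 in
  T s -> T t -> g * s = 1 + t ->
  (bounded_elt (adjoin T g) t) -> exists k : R, T (k *: 1 - \sum_i x i ^+ 2).
Proof.
move=> rho0 g Ts Tt gs [k k0 [[a [b [Ta Tb kt]]] _]].
set N := \sum_i _ in g gs kt *.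
have TN : T N by exact: semiring_sum.
have Tg1 : T (g * (1 + t)).
  by rewrite -gs mulrA -expr2; exact: semiringM.
have Tkt : T ((1 + t) * (k *: 1 - t)).
  have -> : (1 + t) * (k *: 1 - t) = (1 + t) * a + g * (1 + t) * b.
    by rewrite kt; ring.
  apply: semiringD => //; apply: semiringM => //.
  by apply: semiringD => //; exact: semiring1.
pose m := k + (k / 2) ^+ 2.
have Tm : T (m *: 1 - t).
  have -> : m *: 1 - t = (1 + t) * (k *: 1 - t) + (t - (k / 2) *: 1) ^+ 2.
    have -> : m *: 1 = k *: 1 + ((k / 2) *: 1) ^+ 2 :> A.
      by rewrite /m scalerDl [in RHS]exprZn [in RHS]expr1n.
    have -> : k *: 1 = (k / 2) *: 1 + (k / 2) *: 1 :> A.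
      by rewrite -scalerDl; congr (_ *: _); field.
    by ring.
  exact: semiringD.
exists (rho * (1 + m)).
have -> : (rho * (1 + m)) *: 1 - N = g * (1 + t) + rho *: (m *: 1 - t) + t * N.
  have -> : rho *: (m *: 1 - t) = (rho *: 1) * (m *: 1 - t) :> A.
    by rewrite -[RHS]scalerAl mul1r.
  have -> : (rho * (1 + m)) *: 1 = (rho *: 1) * (1 + m *: 1) :> A.
    by rewrite -[RHS]scalerAl mul1r scalerDr scalerA -scalerDl mulrDr mulr1.
  by rewrite /g; ring.
by do 2?[apply: semiringD => //]; [exact: semiringZ|exact: semiringM].
Qed.

End Woermann.

End SemiringTheory.

Section PolynomialSemirings.
Variables (R : realType) (d : nat).
Local Notation mpol := {mpoly R[d]}.
Local Notation X i := (mpolyX R (mnm1 i) : mpol).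

Lemma mpoly_ind_alg (P : mpol -> Prop) :
  (forall k : R, P k%:A) -> (forall i, P (X i)) ->
  (forall p q, P p -> P q -> P (p + q)) ->
  (forall p q, P p -> P q -> P (p * q)) -> forall p, P p.
Proof.
move=> PC PX PD PM p; rewrite [p]mpolyE.
elim/big_rec: _ => [|m q _ Pq]; first by rewrite -(scale0r 1); exact: PC.
apply: (PD) => //; rewrite -[mpolyX _ _]mul1r scalerAl; apply: (PM) => //.
rewrite mpolyXE_id; elim/big_rec: _ => [|i b _ Pb].
  by rewrite -(scale1r 1); exact: PC.
apply: (PM) => //; elim: (fun_of_multinom m i) => [|n IH].
  by rewrite expr0 -(scale1r 1); exact: PC.
by rewrite exprS; apply: (PM).
Qed.

Lemma archimedean_of_vars (S : set mpol) : is_semiring S ->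
  (forall i, bounded_elt S (X i)) -> archimedean S.
Proof.
move=> semS SX a; elim/mpoly_ind_alg: a => //.
- by move=> k; exact: bounded_eltC.
- by move=> p q; exact: bounded_eltD.
- by move=> p q; exact: bounded_eltM.
Qed.

(** Otherwise T - g T extends to an ordering in which g <= 0, and a point with the
same signs on C and g exists by [artin_lang]. *)
Lemma positivstellensatz (T : set mpol) (C : seq mpol) (g : mpol) :
  preordering T -> {in C, forall c, T c} ->
  (forall x : 'I_d -> R, {in C, forall c, 0 <= c.@[x]} -> 0 < g.@[x]) ->
  exists s t, [/\ T s, T t & g * s = 1 + t].
Proof.
move=> pT CT gpos.
have [[a [b [Ta Tb E1]]]|n1] := pselect (adjoin T (- g) (-1)).
  by exists b, a; split => //; rewrite -[1]opprK E1; ring.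
have [E [phi phiT]] := preordering_field (preordering_adjoin _ pT) n1.
have [x xP] := artin_lang phi (g :: C).
have : 0 < g.@[x].
  apply: gpos => c cC; rewrite -sgz_ge0 -xP ?inE ?cC ?orbT // sgz_ge0.
  by apply: phiT; apply: adjoin_sub => //; exact: CT.
rewrite -sgz_gt0 -xP ?inE ?eqxx // sgz_gt0 ltNge => /negP[].
rewrite -oppr_ge0 -rmorphN; apply: phiT; exact: adjoin_mem.
Qed.

(** The preordering T + g T is Archimedean because it contains rho - sum x_i^2;
[woermann] carries this over to T. *)
Lemma archimedean_preordering (T : set mpol) (C : seq mpol) (rho : R) :
  is_semiring T -> (forall p, T (p ^+ 2)) -> {in C, forall c, T c} ->
  (forall x : 'I_d -> R, {in C, forall c, 0 <= c.@[x]} ->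
     \sum_i x i ^+ 2 < rho) ->
  archimedean T.
Proof.
move=> semT sqT CT bnd.
have bnd' x : {in C, forall c, 0 <= c.@[x]} -> \sum_i x i ^+ 2 < `|rho|.
  by move=> /bnd h; apply: (lt_le_trans h); exact: ler_norm.
pose g : mpol := `|rho| *: 1 - \sum_i X i ^+ 2.
have pT := semiring_preordering semT sqT.
have [|s [t [Ts Tt gs]]] := @positivstellensatz T C g pT CT.
  move=> x /bnd'; rewrite -subr_gt0; congr (0 < _).
  rewrite mevalB mevalZ meval1 mulr1; congr (_ - _).
  rewrite raddf_sum; apply: eq_bigr => i _.
  by rewrite /= !expr2 mevalM mevalXU.
have semT0 := semiring_adjoin semT sqT g.
have sqT0 p : adjoin T g (p ^+ 2) by apply: adjoin_sub.
have T0bnd : bounded_elt (adjoin T g) t.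
  apply: archimedean_of_vars => //.
  exact: (bounded_of_sum_squares semT0 sqT0 (adjoin_mem g pT)).
have [k Tk] := woermann semT sqT (normr_ge0 rho) Ts Tt gs T0bnd.
apply: archimedean_of_vars => //.
exact: (bounded_of_sum_squares semT sqT Tk).
Qed.

End PolynomialSemirings.

(** * The Positivstellensatz for Archimedean semirings *)

Section ConeState.
Context {R : realType} {V : lmodType R}.
Variables (M : set V) (e : V).
Hypothesis MD : forall u v, M u -> M v -> M (u + v).
Hypothesis MZ : forall (k : R) u, 0 <= k -> M u -> M (k *: u).
Hypothesis Mtot : forall u, M u \/ M (- u).
Hypothesis Me : ~ M (- e).

Definition cone_bounded v := exists k : R, M (k *: e - v) /\ M (k *: e + v).

(** The number a with a e equal to v up to infinitesimals, for the order given
by M. *)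
Definition cone_val v (a : R) := forall eps : R, 0 < eps ->
  M (v - (a - eps) *: e) /\ M ((a + eps) *: e - v).

Lemma cone_neg (k : R) : M (k *: e) -> 0 <= k.
Proof.
move=> Mk; rewrite leNgt; apply/negP => k0; apply: Me.
have -> : - e = (- k)^-1 *: (k *: e).
  by rewrite scalerA invrN mulNr mulVf ?scaleN1r // lt_eqF.
by apply: MZ => //; rewrite invr_ge0 oppr_ge0 ltW.
Qed.

(** a is the supremum of the r such that v - r e belongs to M. *)
Lemma cone_val_exists v : cone_bounded v -> exists a, cone_val v a.
Proof.
move=> [k [Mk Mk']].
pose S := [set r : R | M (v - r *: e)].
have ubS r : S r -> r <= k.
  move=> Sr; rewrite -subr_ge0; apply: cone_neg; rewrite scalerBl.
  have -> : k *: e - r *: e = (k *: e - v) + (v - r *: e).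
    by rewrite addrA subrK.
  exact: MD.
have hS : has_sup S.
  split; first by exists (- k); rewrite /S /= scaleNr opprK addrC.
  by exists k => r /ubS.
exists (sup S) => eps eps0; split.
  have [r Sr ltr] := sup_adherent eps0 hS.
  have -> : v - (sup S - eps) *: e = (v - r *: e) + (r - (sup S - eps)) *: e.
    by rewrite [in RHS]scalerBl addrA subrK.
  apply: MD => //; apply: MZ; first by rewrite subr_ge0 ltW.
  by have [//|/Me] := Mtot e.
have [Sr|] := Mtot (v - (sup S + eps) *: e).
  have := sup_upper_bound hS Sr.
  by rewrite gerDl leNgt eps0.
by rewrite opprB.
Qed.

Lemma cone_val_le u v a b : cone_val u a -> cone_val v b -> M (v - u) -> a <= b.
Proof.
move=> ua vb Mvu; apply/ler_addgt0Pr => eps eps0.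
have eps20 : 0 < eps / 2 by rewrite divr_gt0.
have [Mu _] := ua _ eps20; have [_ Mv] := vb _ eps20.
rewrite -subr_ge0; apply: cone_neg.
have -> : (b + eps - a) *: e
  = ((b + eps / 2) *: e - v) + (v - u) + (u - (a - eps / 2) *: e).
  rewrite [_ - v + (v - u)]addrA subrK addrA subrK -scalerBl; congr (_ *: _).
  by field.
by apply: MD => //; apply: MD.
Qed.

Lemma cone_0 : M 0.
Proof. by case: (Mtot 0); rewrite ?oppr0. Qed.

Definition state v : R := xget 0 (cone_val v).

Lemma stateP v : cone_bounded v -> cone_val v (state v).
Proof. by move=> /cone_val_exists[a va]; apply: (xgetPex 0); exists a. Qed.

Lemma state_eq v a : cone_val v a -> state v = a.
Proof.
move=> va; have h : cone_val v (state v) by apply: (xgetPex 0); exists a.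
by apply/le_anti/andP; split; [apply: (cone_val_le h va)|apply: (cone_val_le va h)];
  rewrite subrr; exact: cone_0.
Qed.

Lemma state_ge0 v : cone_bounded v -> M v -> 0 <= state v.
Proof.
move=> bv Mv; apply: (@cone_val_le 0 v) => //; last by rewrite subr0.
  move=> eps eps0; rewrite !sub0r !add0r scaleNr opprK subr0.
  have Me' : M e by have [//|/Me] := Mtot e.
  by split; apply: MZ => //; exact: ltW.
exact: stateP.
Qed.

Lemma stateD u v : cone_bounded u -> cone_bounded v ->
  state (u + v) = state u + state v.
Proof.
move=> /stateP bu /stateP bv; apply: state_eq => eps eps0.
have eps20 : 0 < eps / 2 by rewrite divr_gt0.
have [u1 u2] := bu _ eps20; have [v1 v2] := bv _ eps20; split.
  have -> : u + v - (state u + state v - eps) *: e =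
    (u - (state u - eps / 2) *: e) + (v - (state v - eps / 2) *: e).
    rewrite addrACA -opprD -scalerDl; congr (_ - _ *: _).
    by field.
  exact: MD.
have -> : (state u + state v + eps) *: e - (u + v) =
    ((state u + eps / 2) *: e - u) + ((state v + eps / 2) *: e - v).
  rewrite addrACA -opprD -scalerDl; congr (_ *: _ - _).
  by field.
exact: MD.
Qed.

Lemma stateN u : cone_bounded u -> state (- u) = - state u.
Proof.
move=> /stateP bu; apply: state_eq => eps eps0; have [u1 u2] := bu _ eps0.
split.
  by move: u2; congr M; rewrite -[- state u - eps]opprD scaleNr opprK addrC.
by move: u1; congr M; rewrite opprK -scaleNr addrC opprB [eps - _]addrC.
Qed.

Lemma stateZ (k : R) u : cone_bounded u -> state (k *: u) = k * state u.
Proof.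
have pos l : 0 <= l -> cone_bounded u -> state (l *: u) = l * state u.
  rewrite le_eqVlt => /orP[/eqP <- _|l0 /stateP bu].
    rewrite scale0r mul0r; apply: state_eq => eps eps0.
    rewrite !sub0r !add0r scaleNr opprK subr0.
    have Me' : M e by have [//|/Me] := Mtot e.
    by split; apply: MZ => //; exact: ltW.
  apply: state_eq => eps eps0.
  have epsl : 0 < eps / l by rewrite divr_gt0.
  have [/(MZ (ltW l0)) u1 /(MZ (ltW l0)) u2] := bu _ epsl.
  have lE : l * (eps / l) = eps by rewrite mulrC divfK // gt_eqF.
  split.
    by move: u1; rewrite scalerBr scalerA mulrBr lE.
  by move: u2; rewrite scalerBr scalerA mulrDr lE.
move=> bu; have [k0|k0] := leP 0 k; first exact: pos.
have bNu : cone_bounded (k *: u).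
  have [c [c1 c2]] := bu; have k0' : 0 <= - k by rewrite oppr_ge0 ltW.
  exists (- k * c); move: (MZ k0' c1) (MZ k0' c2).
  by rewrite !scalerDr !scalerA !scalerN !scaleNr opprK => ? ?; split.
rewrite -[LHS]opprK -stateN // -scaleNr pos ?oppr_ge0 ?ltW //.
by rewrite mulNr opprK.
Qed.

Lemma state_unit : state e = 1.
Proof.
have Me' : M e by have [//|/Me] := Mtot e.
apply: state_eq => eps eps0; rewrite -[X in X - _]scale1r -scalerBl.
rewrite -[X in _ /\ M (_ - X)]scale1r -scalerBl.
by split; apply: MZ => //; lra.
Qed.

End ConeState.

Section ArchimedeanSemiring.
Context {R : realType} {A : comAlgType R}.
Variable S : set A.
Hypothesis semS : is_semiring S.
Hypothesis archS : archimedean S.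

Definition semimodule (M : set A) : Prop :=
  (forall a b, M a -> M b -> M (a + b)) /\ (forall s a, S s -> M a -> M (s * a)).

(** If neither a nor -a belongs to a maximal S-module M without -1, then
-1 = m1 + a s1 = m2 - a s2.  Eliminating a shows that s1 and -s1 lie in M.
Since a is a difference of elements of S, also a s1 is in M, and so is -1. *)
Lemma maximal_semimodule (M0 : set A) : semimodule M0 -> S `<=` M0 -> ~ M0 (-1) ->
  exists M, [/\ semimodule M, M0 `<=` M, ~ M (-1) & forall a, M a \/ M (- a)].
Proof.
move=> mM0 SM0 nM0.
have [] := @zorn_above A [set M | semimodule M /\ ~ M (-1)] M0 (conj mM0 nM0).
  move=> F [X0 FX0] FP Ftot; split; last by move=> [X FX]; apply: (FP X FX).2.
  split.
    move=> a b [X FX Xa] [Y FY Yb]; have [h|h] := Ftot _ _ FX FY.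
      by exists Y => //; have [[YD _] _] := FP Y FY; apply: (YD) => //; exact: h.
    by exists X => //; have [[XD _] _] := FP X FX; apply: (XD) => //; exact: h.
  move=> s a Ss [X FX Xa]; exists X => //.
  by have [[_ XM] _] := FP X FX; exact: XM.
move=> M [[mM nM] MM Mmax]; exists M; split => // a.
have [MD MS] := mM; have SM : S `<=` M by move=> s /SM0/MM.
have M0' : M 0 by apply: SM; exact: semiring0.
have adj c : ~ M c -> exists m s, [/\ M m, S s & - 1 = m + c * s].
  move=> nMc; pose M' := [set x | exists m s, [/\ M m, S s & x = m + c * s]].
  have mM' : semimodule M'.
    split.
      move=> _ _ [m [s [Mm Ss ->]]] [m' [s' [Mm' Ss' ->]]].
      exists (m + m'), (s + s'); split; [exact: MD|exact: semiringD|ring].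
    move=> t _ St [m [s [Mm Ss ->]]]; exists (t * m), (t * s).
    by split; [exact: MS|exact: semiringM|ring].
  have [//|nM'] := pselect (M' (-1)).
  exfalso; apply: nMc; apply: (Mmax M') => //.
    by move=> x Mx; exists x, 0; split => //; [exact: semiring0|ring].
  by exists 0, 1; split => //; [exact: semiring1|ring].
apply: contrapT => /not_orP[/adj[m1 [s1 [Mm1 Ss1 E1]]] /adj[m2 [s2 [Mm2 Ss2 E2]]]].
have Ms : M (- (s1 + s2)).
  have -> : - (s1 + s2) = s2 * m1 + s1 * m2.
    have -> : m1 = - 1 - a * s1 by rewrite E1; ring.
    have -> : m2 = - 1 + a * s2 by rewrite E2; ring.
    by ring.
  by apply: (MD); exact: MS.
have MNs1 : M (- s1).
  have -> : - s1 = - (s1 + s2) + s2 by ring.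
  by apply: (MD) => //; exact: SM.
have [k k0 [_ Ska]] := archS a.
apply: nM; rewrite E1; apply: (MD) => //.
have -> : a * s1 = (k *: 1 + a) * s1 + (k *: 1) * (- s1) by ring.
apply: (MD); apply: MS => //; first exact: SM.
by apply: semiringC => //; exact: ltW.
Qed.

(** The state of a maximal S-module M is multiplicative: for s in S,
multiplication by s preserves M, hence it carries the inequalities that define
the value of a to those for a s; and S spans A. *)
Lemma semiring_character (M0 : set A) : semimodule M0 -> S `<=` M0 -> ~ M0 (-1) ->
  exists alpha : A -> R,
  [/\ forall a b, alpha (a + b) = alpha a + alpha b,
      forall a b, alpha (a * b) = alpha a * alpha b,
      forall k : R, alpha k%:A = k & forall a, M0 a -> 0 <= alpha a].
Proof.
move=> mM0 SM0 nM0.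
have [M [[MD MS] MM nM Mtot]] := maximal_semimodule mM0 SM0 nM0.
have SM : S `<=` M by move=> s /SM0/MM.
have MZ (k : R) u : 0 <= k -> M u -> M (k *: u).
  move=> k0 Mu; rewrite -[u]mul1r scalerAl; apply: MS => //.
  exact: semiringC.
have bnd a : cone_bounded M 1 a.
  by have [k _ [h1 h2]] := archS a; exists k; split; exact: SM.
pose al := state M 1.
have alD a b : al (a + b) = al a + al b by exact: stateD.
have alN a : al (- a) = - al a by exact: stateN.
have alZ k a : al (k *: a) = k * al a by exact: stateZ.
have al1 : al 1 = 1 by exact: state_unit.
have al0 a : M a -> 0 <= al a by exact: state_ge0.
have alM_S a s : S s -> al (a * s) = al a * al s.
  move=> Ss; have s0 : 0 <= al s by apply/al0/SM.
  have va := stateP MD MZ Mtot nM (bnd a).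
  have d0 eps : 0 < eps -> 0 < eps / (al s + 1).
    by move=> eps0; rewrite divr_gt0 // ltr_wpDl.
  have dle eps : 0 < eps -> eps / (al s + 1) * al s <= eps.
    move=> eps0; rewrite mulrAC ler_pdivrMr ?ltr_wpDl //.
    by apply: ler_wpM2l; [exact: ltW|rewrite lerDl].
  apply/le_anti/andP; split; apply/ler_addgt0Pr => eps eps0.
    have [_ /(MS _ _ Ss)/al0] := va _ (d0 _ eps0).
    rewrite mulrBr -scalerAr mulr1 alD alN alZ -/al subr_ge0 [s * a]mulrC => h.
    by apply: (le_trans h); rewrite mulrDl lerD2l dle.
  have [/(MS _ _ Ss)/al0 + _] := va _ (d0 _ eps0).
  rewrite mulrBr -scalerAr mulr1 alD alN alZ -/al subr_ge0 [s * a]mulrC.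
  rewrite mulrBl lerBlDr => h; apply: (le_trans h); by rewrite lerD2l dle.
exists al; split => //.
- move=> a b; have [k k0 [_ Skb]] := archS b.
  have Sk : S (k *: 1) by apply: semiringC => //; exact: ltW.
  have := alM_S a _ Skb; rewrite mulrDr !alD (alM_S a _ Sk) mulrDr.
  by move/addrI.
- by move=> k; rewrite alZ al1 mulr1.
- by move=> a /MM/al0.
Qed.

(** With k - s in S and r >= 0, q + r in S implies q + r - 1/k in S, because
(k - s)(q + r) + t + r s = k (q + r) - 1.  Starting from r = n / k, the
descent reaches r = 0. *)
Lemma semiring_of_multiple q s t : S s -> S t -> q * s = 1 + t -> S q.
Proof.
move=> Ss St qs; have [k k0 [Sks _]] := archS s.
suff H n : S (q + (n%:R / k) *: 1) -> S q.
  have [l l0 [_ Slq]] := archS q.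
  apply: (H (Num.bound (l * k))).
  set n := Num.bound _.
  have ln : l <= n%:R / k.
    rewrite ler_pdivlMr //; apply/ltW/archi_boundP.
    by rewrite mulr_ge0 // ltW.
  have -> : q + (n%:R / k) *: 1 = (l *: 1 + q) + (n%:R / k - l) *: 1.
    by rewrite scalerBl; ring.
  by apply: semiringD => //; apply: semiringC => //; rewrite subr_ge0.
elim: n => [|n IH] Sn; first by move: Sn; rewrite mul0r scale0r addr0.
apply: IH; set r := n.+1%:R / k in Sn.
have r0 : 0 <= r by rewrite divr_ge0 // ltW.
have -> : q + (n%:R / k) *: 1 =
    k^-1 *: ((k *: 1 - s) * (q + r *: 1) + t + r *: 1 * s).
  have -> : (k *: 1 - s) * (q + r *: 1) + t + r *: 1 * s
     = k *: 1 * (q + r *: 1) - 1.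
    have -> : t = q * s - 1 by rewrite qs; ring.
    by ring.
  rewrite -scalerAl mul1r scalerBr scalerA mulVf ?gt_eqF // scale1r -addrA -scalerBl.
  have kn0 : k != 0 by rewrite gt_eqF.
  by congr (_ + _ *: _); rewrite /r -natr1; field.
apply: semiringZ => //; first by rewrite invr_ge0 ltW.
apply: semiringD => //; first by apply: semiringD => //; exact: semiringM.
by apply: semiringM => //; exact: semiringC.
Qed.

End ArchimedeanSemiring.

(** A character of the polynomial ring is the evaluation at a point; the
character nonnegative on S - q S would be a point with q <= 0. *)
Theorem archimedean_positivstellensatz (R : realType) (d : nat)
    (S : set {mpoly R[d]}) (q : {mpoly R[d]}) :
  is_semiring S -> archimedean S ->
  (forall x : 'I_d -> R, (forall a, S a -> 0 <= a.@[x]) -> 0 < q.@[x]) -> S q.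
Proof.
move=> semS archS qpos.
pose M0 := [set x | exists a b, [/\ S a, S b & x = a - q * b]].
have SM0 : S `<=` M0.
  by move=> a Sa; exists a, 0; split => //; [exact: semiring0|ring].
have mM0 : semimodule S M0.
  split.
    move=> _ _ [a [b [Sa Sb ->]]] [a' [b' [Sa' Sb' ->]]].
    by exists (a + a'), (b + b'); split; [exact: semiringD|exact: semiringD|ring].
  move=> s _ Ss [a [b [Sa Sb ->]]].
  by exists (s * a), (s * b); split; [exact: semiringM|exact: semiringM|ring].
have [[a [b [Sa Sb E1]]]|n1] := pselect (M0 (-1)).
  apply: (semiring_of_multiple semS archS Sb Sa).
  by rewrite -[1]opprK E1; ring.
have [al [alD alM alC al0]] := semiring_character semS archS mM0 SM0 n1.
pose x i := al (mpolyX R (mnm1 i)).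
have alE p : al p = p.@[x].
  elim/mpoly_ind_alg: p => [k|i|p r|p r].
  - by rewrite alC mevalZ meval1 mulr1.
  - by rewrite mevalXU.
  - by rewrite alD mevalD => -> ->.
  - by rewrite alM mevalM => -> ->.
have : 0 < q.@[x] by apply: qpos => a /SM0/al0; rewrite alE.
rewrite ltNge -oppr_ge0 -mevalN -alE => /negP[]; apply: al0.
exists 0, 1; split; [exact: semiring0|exact: semiring1|ring].
Qed.

(** * Extension of positive functionals to bounded functions *)

(** From -e = m1 + k1 u = m2 - k2 u with k1, k2 > 0, the combination with
coefficients k2 and k1 eliminates u and puts -e into the cone. *)
Lemma maximal_cone (R : realType) (V : lmodType R) (e : V) (M0 : set V) :
  M0 0 -> (forall u v, M0 u -> M0 v -> M0 (u + v)) ->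
  (forall (k : R) u, 0 <= k -> M0 u -> M0 (k *: u)) -> ~ M0 (- e) ->
  exists M, [/\ M0 `<=` M, forall u v, M u -> M v -> M (u + v),
    forall (k : R) u, 0 <= k -> M u -> M (k *: u), ~ M (- e)
    & forall u, M u \/ M (- u)].
Proof.
move=> M00 M0D M0Z nM0.
pose cone (M : set V) := (forall u v, M u -> M v -> M (u + v)) /\
  (forall (k : R) u, 0 <= k -> M u -> M (k *: u)).
have [] := @zorn_above V [set M | cone M /\ ~ M (- e)] M0 (conj (conj M0D M0Z) nM0).
  move=> F [X0 FX0] FP Ftot; split; last by move=> [X FX]; apply: (FP X FX).2.
  split.
    move=> a b [X FX Xa] [Y FY Yb]; have [h|h] := Ftot _ _ FX FY.
      by exists Y => //; have [[YD _] _] := FP Y FY; apply: (YD) => //; exact: h.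
    by exists X => //; have [[XD _] _] := FP X FX; apply: (XD) => //; exact: h.
  move=> k a k0 [X FX Xa]; exists X => //.
  by have [[_ XZ] _] := FP X FX; exact: XZ.
move=> M [[[MD MZ] nM] MM Mmax]; exists M; split => // u.
have M0' : M 0 by exact: MM.
have adj c : ~ M c -> exists (m : V) (k : R), [/\ M m, 0 < k & - e = m + k *: c].
  move=> nMc; pose M' := [set x | exists (m : V) (k : R), [/\ M m, 0 <= k & x = m + k *: c]].
  have cM' : cone M'.
    split.
      move=> _ _ [m [k [Mm k0 ->]]] [m' [k' [Mm' k0' ->]]].
      exists (m + m'), (k + k'); split; [exact: MD|exact: addr_ge0|].
      by rewrite scalerDl addrACA.
    move=> t _ t0 [m [k [Mm k0 ->]]]; exists (t *: m), (t * k).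
    by split; [exact: MZ|exact: mulr_ge0|rewrite scalerDr scalerA].
  have [[m [k [Mm k0 E1]]]|nM'] := pselect (M' (- e)).
    exists m, k; split => //; rewrite lt_neqAle k0 andbT; apply/eqP => k0'.
    by apply: nM; rewrite E1 -k0' scale0r addr0.
  exfalso; apply: nMc; apply: (Mmax M') => //.
    by move=> x Mx; exists x, 0; split => //; rewrite scale0r addr0.
  by exists 0, 1; split => //; rewrite scale1r add0r.
apply: contrapT => /not_orP[/adj[m1 [k1 [Mm1 k10 E1]]] /adj[m2 [k2 [Mm2 k20 E2]]]].
apply: nM.
have -> : - e = (k1 + k2)^-1 *: (k2 *: m1 + k1 *: m2).
  have k12 : k1 + k2 != 0 by rewrite gt_eqF // addr_gt0.
  apply: (scalerI k12); rewrite scalerA divff // scale1r.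
  have -> : m1 = - e - k1 *: u by rewrite E1 addrK.
  have -> : m2 = - e + k2 *: u by rewrite E2 scalerN subrK.
  rewrite !scalerDr !scalerN !scalerA [k2 * k1]mulrC.
  rewrite addrACA [- _ + _ *: u]addrC subrr addr0 -!scalerN -scalerDl.
  by rewrite addrC.
apply: (MZ); first by rewrite invr_ge0 addr_ge0 // ltW.
by apply: (MD); apply: MZ => //; exact: ltW.
Qed.

Section Extension.
Variables (R : realType) (d : nat) (K : set 'rV[R]_d).
Variable L : {scalar {mpoly R[d]}}.
Hypothesis Lpos : forall p : {mpoly R[d]},
  (forall x, K x -> 0 <= p.@[x ord0]) -> 0 <= L p.
Hypothesis bndK : forall p : {mpoly R[d]},
  exists c : R, forall x, K x -> `|p.@[x ord0]| <= c.

Definition bounded_on (g : 'rV[R]_d -> R) := exists c : R, forall x, K x -> `|g x| <= c.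

Definition pfun (p : {mpoly R[d]}) : 'rV[R]_d -> R := fun x => p.@[x ord0].

(** M. Riesz's extension: the cone of functions that dominate on K a polynomial
with nonnegative value is enlarged to a maximal cone without -1, whose state
is L / L 1 on polynomials.  If L 1 = 0, positivity makes L vanish and the zero
functional extends it. *)
Lemma positive_extension : exists Lam : ('rV[R]_d -> R) -> R,
  [/\ forall g h, bounded_on g -> bounded_on h -> Lam (g + h) = Lam g + Lam h,
      forall (k : R) g, bounded_on g -> Lam (k *: g) = k * Lam g,
      forall g h, bounded_on g -> bounded_on h ->
        (forall x, K x -> g x <= h x) -> Lam g <= Lam h
    & forall p, Lam (pfun p) = L p].
Proof.
have L1 : 0 <= L 1 by apply: Lpos => x _; rewrite meval1.
have [L10|L10] := eqVneq (L 1) 0.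
  exists (fun=> 0); split => // [||p].
  - by move=> g h _ _; rewrite addr0.
  - by move=> k g _; rewrite mulr0.
  have [c bc] := bndK p.
  have Lc : L (c *: 1) = 0 by rewrite linearZ /= L10 mulr0.
  apply/le_anti/andP; split.
    rewrite -[L p]addr0 -[X in _ + X]Lc -linearD; apply: Lpos => x /bc.
    by rewrite mevalD mevalZ meval1 mulr1 ler_norml => /andP[]; lra.
  rewrite -subr_ge0 -[X in X - _]Lc -linearB; apply: Lpos => x /bc.
  by rewrite mevalB mevalZ meval1 mulr1 ler_norml => /andP[]; lra.
have {L10}L10 : 0 < L 1 by rewrite lt_neqAle eq_sym L10.
pose e : 'rV[R]_d -> R := pfun 1.
have eE x : e x = 1 by exact: meval1.
pose M0 := [set g : 'rV[R]_d -> R | exists p : {mpoly R[d]},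
  0 <= L p /\ forall x, K x -> p.@[x ord0] <= g x].
have [] := @maximal_cone R ('rV[R]_d -> R : lmodType R) e M0.
- by exists 0; rewrite linear0; split => // x _; rewrite meval0.
- move=> g h [p [Lp pg]] [q [Lq qh]]; exists (p + q); split.
    by rewrite linearD addr_ge0.
  by move=> x Kx; rewrite mevalD lerD ?pg ?qh.
- move=> k g k0 [p [Lp pg]]; exists (k *: p); split.
    by rewrite linearZ /= mulr_ge0.
  by move=> x Kx; rewrite mevalZ ler_wpM2l ?pg.
- move=> [p [Lp pe]]; have : 0 <= L (- 1 - p).
    apply: Lpos => x /pe; rewrite mevalB mevalN meval1 subr_ge0.
    by rewrite -[X in _ <= X -> _]/(- e x) eE.
  by rewrite linearB linearN; lra.
move=> M [M0M MD MZ Me Mtot].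
have bM g : bounded_on g -> cone_bounded M e g.
  move=> [c bc]; exists c; split; apply: M0M; exists 0; rewrite linear0; split => // x /bc;
    rewrite meval0 ler_norml => /andP[h1 h2].
    by rewrite -[X in _ <= X]/(c * e x - g x) eE mulr1 subr_ge0.
  by rewrite -[X in _ <= X]/(c * e x + g x) eE mulr1; lra.
exists (fun g => L 1 * state M e g); split.
- by move=> g h /bM bg /bM bh; rewrite (stateD MD MZ Mtot Me bg bh) mulrDr.
- by move=> k g /bM bg; rewrite (stateZ MD MZ Mtot Me _ bg) mulrCA.
- move=> g h bg bh gh; apply: ler_wpM2l => //.
  apply: (cone_val_le MD MZ Me (stateP MD MZ Mtot Me (bM _ bg))
    (stateP MD MZ Mtot Me (bM _ bh))).
  apply: M0M; exists 0; rewrite linear0; split => // x Kx.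
  by rewrite meval0 -[X in _ <= X]/(h x - g x) subr_ge0 gh.
move=> p; rewrite (@state_eq _ _ M e MD MZ Mtot Me _ (L p / L 1)).
  by rewrite mulrC divfK // gt_eqF.
move=> eps eps0; split; apply: M0M.
  exists (p - (L p / L 1 - eps) *: 1); split.
    rewrite linearB linearZ /= mulrBl divfK ?gt_eqF // opprB addrC subrK.
    by rewrite mulr_ge0 // ltW.
  move=> x _; rewrite mevalB mevalZ meval1.
  by rewrite -[X in _ <= X]/(p.@[x ord0] - (L p / L 1 - eps) * e x) eE.
exists ((L p / L 1 + eps) *: 1 - p); split.
  rewrite linearB linearZ /= mulrDl divfK ?gt_eqF // addrC addrA addNr add0r.
  by rewrite mulr_ge0 // ltW.
move=> x _; rewrite mevalB mevalZ meval1.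
by rewrite -[X in _ <= X]/((L p / L 1 + eps) * e x - p.@[x ord0]) eE.
Qed.

End Extension.

(** * From a finitely additive content to a Radon measure *)

Section ContentMeasure.
Variables (R : realType) (d : nat).
Local Notation T := 'rV[R]_d.
Variables (K : set T) (m : set T -> R).
Hypothesis cK : compact K.
Hypothesis m_ge0 : forall A, 0 <= m A.
Hypothesis mU : forall A B, A `&` B = set0 -> m (A `|` B) = m A + m B.
Hypothesis mK : forall A, m A = m (A `&` K).

Lemma content0 : m set0 = 0.
Proof.
have := @mU set0 set0; rewrite setI0 setU0 => /(_ erefl)/eqP.
by rewrite -subr_eq subrr => /eqP.
Qed.

Lemma le_content A B : A `<=` B -> m A <= m B.
Proof.
move=> AB; have -> : B = A `|` (B `\` A) by rewrite setDUK.
by rewrite mU ?setDIK // lerDl.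
Qed.

(** Finite subadditivity only; countable subadditivity is what regularization
provides. *)
Lemma content_bigcup_le (C : nat -> set T) n :
  m (\bigcup_(i in `I_n) C i) <= \sum_(i < n) m (C i).
Proof.
elim: n => [|n IH]; first by rewrite II0 bigcup_set0 content0 big_ord0.
rewrite big_ord_recr /= IIS bigcup_setU bigcup_set1.
set X := \bigcup_(i in _) _.
have -> : X `|` C n = X `|` (C n `\` X).
  by rewrite setDE setUIr setUv setIT.
rewrite mU; last by rewrite setDIK.
by apply: lerD => //; apply: le_content; exact: subDsetl.
Qed.

Definition inner (U : set T) : \bar R :=
  ereal_sup [set (m C)%:E | C in [set C | closed C /\ C `<=` U]].

Lemma inner_ub U C : closed C -> C `<=` U -> ((m C)%:E <= inner U)%E.
Proof. by move=> cC CU; apply: ereal_sup_ubound; exists C. Qed.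

Lemma inner_le U (x : \bar R) :
  (forall C, closed C -> C `<=` U -> ((m C)%:E <= x)%E) -> (inner U <= x)%E.
Proof. by move=> H; apply: ge_ereal_sup => _ [C [cC CU] <-]; exact: H. Qed.

Lemma inner_ge0 U : (0 <= inner U)%E.
Proof.
have : ((m set0)%:E <= inner U)%E by apply: inner_ub; [exact: closed0|move=> x].
by rewrite content0.
Qed.

Lemma inner_le_content U : (inner U <= (m U)%:E)%E.
Proof. by apply: inner_le => C _ CU; rewrite lee_fin le_content. Qed.

Lemma inner_mono U V : U `<=` V -> (inner U <= inner V)%E.
Proof.
by move=> UV; apply: inner_le => C cC CU; apply: inner_ub => // x /CU/UV.
Qed.

Lemma inner_fin U : inner U \is a fin_num.
Proof.
rewrite ge0_fin_numE ?inner_ge0 //; apply: (le_lt_trans (inner_le_content U)).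
by rewrite ltry.
Qed.

(** Compactness of C and K and regularity of the space cover the part of C in K by
finitely many closed sets, each contained in some U_n; grouped by n, they bound
the content of C by finitely many terms of the series. *)
Lemma inner_bigcup (U : nat -> set T) : (forall n, open (U n)) ->
  (inner (\bigcup_n U n) <= \sum_(n <oo) inner (U n))%E.
Proof.
move=> oU; apply: inner_le => C cC CU.
have pick x : exists V : set T * nat, C x ->
    [/\ open V.1, V.1 x & closure V.1 `<=` U V.2].
  have [Cx|] := pselect (C x); last by exists (set0, 0%N).
  have [n _ Unx] := CU x Cx.
  have [W Wx WU] : filter_from (nbhs x) closure (U n).
    by apply: (@uniform_regular _ x); exact: open_nbhs_nbhs.
  exists (W^°, n) => _; split => //=; first exact: open_interior.
  by apply: subset_trans WU; apply: closureS; exact: interior_subset.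
have [V HV] := choice pick.
have cCK : compact (C `&` K) by rewrite setIC; exact: compact_closedI.
have := cCK; rewrite compact_cover => /(_ _ (C `&` K) (fun x => (V x).1))[||D DC CD].
- by move=> x [/HV[]].
- by move=> x [Cx Kx]; exists x => //; have [] := HV x Cx.
pose s : seq T := finmap.enum_fset D.
pose N := (\max_(x <- s) (V x).2).+1.
pose Cn n := \bigcup_(x in [set x | x \in s /\ (V x).2 = n]) closure (V x).1.
have Cn_closed n : closed (Cn n).
  apply: closed_bigcup => [|x _]; last exact: closed_closure.
  by apply: (sub_finite_set _ (finite_seq s)) => x [].
have CnU n : Cn n `<=` U n.
  move=> y [x [xD <-]]; have := DC x xD; rewrite inE => -[Cx _].
  by have [_ _] := HV x Cx; apply.
have CK_Cn : C `&` K `<=` \bigcup_(i in `I_N) Cn i.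
  move=> y /CD[x /= xD Vxy]; exists (V x).2.
    by rewrite /= ltnS; exact: (@leq_bigmax_seq _ s xpredT (fun x => (V x).2)).
  by exists x => //; exact: subset_closure.
apply: (@le_trans _ _ (\sum_(0 <= i < N) inner (U i))%E).
  rewrite big_mkord; apply: (@le_trans _ _ (\sum_(i < N) (m (Cn i))%:E)%E).
    rewrite sumEFin lee_fin mK; apply: le_trans (content_bigcup_le Cn N).
    exact: le_content.
  by apply: lee_sum => i _; exact: inner_ub.
by apply: nneseries_lim_ge => n _ _; exact: inner_ge0.
Qed.

Definition outer (A : set T) : \bar R :=
  ereal_inf [set inner U | U in [set U | open U /\ A `<=` U]].

Lemma outer_lb A U : open U -> A `<=` U -> (outer A <= inner U)%E.
Proof. by move=> oU AU; apply: ereal_inf_lbound; exists U. Qed.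

Lemma outer_ge A (x : \bar R) :
  (forall U, open U -> A `<=` U -> (x <= inner U)%E) -> (x <= outer A)%E.
Proof. by move=> H; apply: le_ereal_inf_tmp => _ [U [oU AU] <-]; exact: H. Qed.

Lemma outer_open U : open U -> outer U = inner U.
Proof.
move=> oU; apply/le_anti/andP; split; first exact: outer_lb.
by apply: outer_ge => V _; exact: inner_mono.
Qed.

Lemma outer_ge0 A : (0 <= outer A)%E.
Proof. by apply: outer_ge => U _ _; exact: inner_ge0. Qed.

Lemma outer_fin A : outer A \is a fin_num.
Proof.
rewrite ge0_fin_numE ?outer_ge0 //.
apply: (@le_lt_trans _ _ (inner setT)); first by apply: outer_lb => //; exact: openT.
by rewrite -ge0_fin_numE ?inner_ge0 ?inner_fin.
Qed.

Lemma outer_mono : {homo outer : A B / A `<=` B >-> (A <= B)%E}.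
Proof.
by move=> A B AB; apply: outer_ge => U oU BU; apply: outer_lb => // x /AB/BU.
Qed.

Lemma outer0 : outer set0 = 0%E.
Proof.
apply/le_anti/andP; split; last exact: outer_ge0.
rewrite outer_open; last exact: open0.
by apply: (le_trans (inner_le_content _)); rewrite content0.
Qed.

Lemma outer_approx A (eps : R) : 0 < eps ->
  exists U, [/\ open U, A `<=` U & (inner U <= outer A + eps%:E)%E].
Proof.
move=> eps0; have [_ [U [oU AU] <-] h] := lb_ereal_inf_adherent eps0 (outer_fin A).
by exists U; split => //; exact: ltW.
Qed.

Lemma outer_sigma_subadditive : sigma_subadditive outer.
Proof.
move=> F; apply/lee_addgt0Pr => eps eps0.
have /choice[U HU] n : exists U, [/\ open U, F n `<=` U &
    (inner U <= outer (F n) + (eps / (2 ^ n.+1)%:R)%:E)%E].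
  by apply: outer_approx; rewrite divr_gt0 // ltr0n expn_gt0.
apply: (@le_trans _ _ (inner (\bigcup_n U n))).
  apply: outer_lb; first by apply: bigcup_open => n _; have [] := HU n.
  by move=> x [n _ Fnx]; exists n => //; have [_ + _] := HU n; apply.
apply: (le_trans (inner_bigcup _)); first by move=> n; have [] := HU n.
apply: (@le_trans _ _ (\sum_(n <oo) (outer (F n) + (eps / (2 ^ n.+1)%:R)%:E))%E).
  apply: lee_nneseries => n _; first by move=> _; exact: inner_ge0.
  by have [] := HU n.
by apply: epsilon_trick => [n|]; [exact: outer_ge0|exact: ltW].
Qed.

HB.instance Definition _ := isOuterMeasure.Build R T outer
  outer0 outer_ge0 outer_mono outer_sigma_subadditive.

(** Inside an open U containing X, take a closed C in U and V and then a
closed C' in U without C, both of nearly full content: they are disjoint, and U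
minus V is contained in U minus C. *)
Lemma open_caratheodory (V : set T) : open V ->
  (outer : {outer_measure set T -> \bar R}).-caratheodory V.
Proof.
move=> oV; apply: le_caratheodory_measurable => X /=.
apply: outer_ge => U oU XU; apply/lee_addgt0Pr => eps eps0.
have oUV : open (U `&` V) by exact: openI.
have eps20 : 0 < eps / 2 by rewrite divr_gt0.
have [_ [C [cC CUV] <-] hC] := ub_ereal_sup_adherent eps20 (inner_fin (U `&` V)).
have oUC : open (U `&` ~` C) by apply: openI => //; exact: closed_openC.
have [_ [C' [cC' CUC] <-] hC'] := ub_ereal_sup_adherent eps20 (inner_fin (U `&` ~` C)).
have h1 : (outer (X `&` V) <= (m C)%:E + (eps / 2)%:E)%E.
  apply: (@le_trans _ _ (inner (U `&` V))).
    by apply: outer_lb => // x [/XU].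
  by rewrite -leeBlDr //; exact: ltW.
have h2 : (outer (X `&` ~` V) <= (m C')%:E + (eps / 2)%:E)%E.
  apply: (@le_trans _ _ (inner (U `&` ~` C))).
    apply: outer_lb => // x [/XU Ux nVx]; split => // /CUV[_ Vx]; exact: nVx.
  by rewrite -leeBlDr //; exact: ltW.
apply: (le_trans (leeD h1 h2)).
have h3 : ((m (C `|` C'))%:E <= inner U)%E.
  apply: inner_ub; first exact: closedU.
  by move=> x [/CUV[]|/CUC[]].
rewrite mU in h3; last first.
  by apply/seteqP; split => // x [Cx /CUC[_]]; exact.
have -> : ((m C)%:E + (eps / 2)%:E + ((m C')%:E + (eps / 2)%:E)
    = (m C + m C')%:E + eps%:E)%E.
  by rewrite -!EFinD; congr EFin; field.
exact: leeD.
Qed.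

Definition content_measure : set (borel_rV R d) -> \bar R := outer.

Lemma borel_caratheodory (B : set (borel_rV R d)) : measurable B ->
  (outer : {outer_measure set T -> \bar R}).-caratheodory B.
Proof.
apply: smallest_sub; last exact: open_caratheodory.
exact: (@sigma_algebra_measurable _ (caratheodory_type outer)).
Qed.

Lemma content_measure_sigma_additive : semi_sigma_additive content_measure.
Proof.
move=> F mF tF mUF.
apply: (@caratheodory_measure_sigma_additive _ _
  (outer : {outer_measure set T -> \bar R})) => //.
  by move=> i; exact: borel_caratheodory.
exact: borel_caratheodory.
Qed.

HB.instance Definition _ := isMeasure.Build _ (borel_rV R d) R content_measure
  outer0 outer_ge0 content_measure_sigma_additive.

Definition cmeasure : {measure set (borel_rV R d) -> \bar R} := content_measure.

Lemma open_borel (U : set T) : open U -> measurable (U : set (borel_rV R d)).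
Proof. exact: sub_gen_smallest. Qed.

Lemma closed_borel (C : set T) : closed C -> measurable (C : set (borel_rV R d)).
Proof.
move=> cC; have : measurable (~` C : set (borel_rV R d)).
  by apply: open_borel; exact: closed_openC.
by move=> /measurableC; rewrite setCK.
Qed.

Lemma closedK : closed K.
Proof. by apply: compact_closed => //; exact: norm_hausdorff. Qed.

Lemma cmeasure_setCK : cmeasure (~` K) = 0%E.
Proof.
apply/le_anti/andP; split; last exact: outer_ge0.
rewrite /cmeasure /= /content_measure outer_open; last exact/closed_openC/closedK.
by apply: (le_trans (inner_le_content _)); rewrite mK setICl content0.
Qed.

Lemma cmeasure_setT : cmeasure setT = (m setT)%:E.
Proof.
rewrite /cmeasure /= /content_measure outer_open; last exact: openT.
apply/le_anti/andP; split; first exact: inner_le_content.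
by apply: inner_ub => //; exact: closedT.
Qed.

Lemma cmeasure_open U : open U -> (cmeasure U <= (m U)%:E)%E.
Proof.
move=> oU; rewrite /cmeasure /= /content_measure outer_open //.
exact: inner_le_content.
Qed.

Lemma cmeasure_K : cmeasure K = (m setT)%:E.
Proof.
have mmK := closed_borel closedK.
rewrite -cmeasure_setT -(setUv K) measureU ?setICr //; last exact: measurableC.
by rewrite -[X in (_ + X)%E]/(cmeasure (~` K)) cmeasure_setCK adde0.
Qed.

(** Outer regularity of the complement of B, relative to the compact set K that
carries the measure, is inner regularity of B by compact sets. *)
Lemma cmeasure_radon : radon cmeasure.
Proof.
split => [C cC|B mB].
  apply: (@le_lt_trans _ _ (cmeasure setT)); last by rewrite cmeasure_setT ltry.
  exact: outer_mono.
apply/le_anti/andP; split; last first.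
  apply: ge_ereal_sup => _ [C [cC CB] <-]; exact: outer_mono.
apply/lee_addgt0Pr => eps eps0.
have [U [oU BU hU]] := outer_approx (~` B) eps0.
have mU' : measurable (U : set (borel_rV R d)) by exact: open_borel.
pose C := K `&` ~` U.
have CB : C `<=` B.
  by move=> x [_ nU]; apply: contrapT => nB; apply: nU; exact: BU.
have cC : compact C by apply: compact_closedI => //; exact: open_closedC.
have mC : measurable (C : set (borel_rV R d)).
  by apply: closed_borel; apply: compact_closed => //; exact: norm_hausdorff.
apply: (@le_trans _ _ (cmeasure C + eps%:E)%E); last first.
  by apply: leeD => //; apply: ereal_sup_ubound; exists C.
(* compare both sides inside [K]: K is covered by C and U *)
have fin X : cmeasure X \is a fin_num by exact: outer_fin.
have mT : cmeasure setT = (cmeasure B + cmeasure (~` B))%E.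
  by rewrite -measureU ?setUv ?setICr //; exact: measurableC.
have mT' : (cmeasure setT <= cmeasure C + cmeasure U)%E.
  rewrite cmeasure_setT -cmeasure_K.
  apply: (le_trans _ (measureU2 _ mC mU')).
  apply: outer_mono => x Kx.
  by have [Ux|nUx] := pselect (U x); [right|left].
have hU' : (cmeasure U <= cmeasure (~` B) + eps%:E)%E.
  by rewrite /cmeasure /= /content_measure outer_open.
have : (cmeasure B + cmeasure (~` B) <= cmeasure C + eps%:E + cmeasure (~` B))%E.
  rewrite -mT; apply: (le_trans mT'); rewrite -addeA [(eps%:E + _)%E]addeC.
  by apply: leeD.
by rewrite leeD2rE.
Qed.

End ContentMeasure.

(** * Integral representation of positive functionals on a compact set *)

Section Riesz.
Variables (R : realType) (d : nat).
Local Notation T := 'rV[R]_d.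

Lemma pfun_continuous (p : {mpoly R[d]}) : continuous (pfun p : T -> R).
Proof.
elim/mpoly_ind_alg: p => [k|i|p q cp cq|p q cp cq].
- have -> : pfun (k%:A : {mpoly R[d]}) = (fun=> k).
    by apply/funext => x; rewrite /pfun mevalZ meval1 mulr1.
  exact: cst_continuous.
- have -> : pfun (mpolyX R (mnm1 i)) = (fun x : T => x ord0 i).
    by apply/funext => x; rewrite /pfun mevalXU.
  exact: coord_continuous.
- have -> : pfun (p + q) = (fun x => pfun p x + pfun q x).
    by apply/funext => x; rewrite /pfun /= mevalD.
  by move=> x; apply: continuousD; [exact: cp|exact: cq].
- have -> : pfun (p * q) = (fun x => pfun p x * pfun q x).
    by apply/funext => x; rewrite /pfun /= mevalM.
  by move=> x; apply: continuousM; [exact: cp|exact: cq].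
Qed.

Lemma pfun_open (p : {mpoly R[d]}) (c : R) : open [set x : T | c < pfun p x].
Proof.
have -> : [set x : T | c < pfun p x] = pfun p @^-1` [set y | c < y] by [].
by apply: open_comp; [move=> x _; exact: pfun_continuous|exact: open_gt].
Qed.

Lemma pfun_measurable (p : {mpoly R[d]}) (D : set (borel_rV R d)) :
  measurable D -> measurable_fun D (pfun p : borel_rV R d -> R).
Proof.
move=> mD; apply: (measurability _ (RGenOInfty.measurableE R)) => //.
move=> _ [_ [c ->] <-]; apply: measurableI => //.
have -> : (pfun p : borel_rV R d -> R) @^-1` `]c, +oo[%classic
   = [set x : T | c < pfun p x].
  by apply/seteqP; split => x /=; rewrite in_itv /= andbT.
apply: open_borel; exact: pfun_open.
Qed.

(** For z in [0, n], the number of integers j < n below z is z rounded up. *)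
Lemma count_levels (n : nat) (z : R) : 0 <= z <= n%:R ->
  z <= \sum_(j < n) (j%:R < z)%R%:R <= z + 1.
Proof.
move=> /andP[z0 zn]; apply/andP; split.
  elim: n zn => [|n IH] zn; first by rewrite big_ord0.
  have [nz|nz] := ltP n%:R z.
    rewrite (eq_bigr (fun=> 1)) => [|j _]; first by rewrite sumr_const card_ord.
    by rewrite (le_lt_trans _ nz) // ler_nat -ltnS.
  by rewrite big_ord_recr /= ltNge nz addr0 IH.
elim: n {zn} => [|n IH]; first by rewrite big_ord0 addr_ge0.
have [nz|nz] := ltP n%:R z; last by rewrite big_ord_recr /= ltNge nz addr0.
apply: (@le_trans _ _ (\sum_(j < n.+1) 1)).
  by apply: ler_sum => j _; case: (_ < _).
by rewrite sumr_const card_ord -natr1 lerD2r ltW.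
Qed.

Variables (K : set T) (L : {scalar {mpoly R[d]}}).
Hypothesis cK : compact K.
Hypothesis Lpos : forall p : {mpoly R[d]},
  (forall x, K x -> 0 <= p.@[x ord0]) -> 0 <= L p.

Lemma pfun_bounded (p : {mpoly R[d]}) :
  exists c : R, forall x, K x -> `|p.@[x ord0]| <= c.
Proof.
have : compact (pfun p @` K).
  by apply: continuous_compact => //; apply: continuous_subspaceT; exact: pfun_continuous.
move=> /compact_bounded[M [_ HM]]; exists (M + 1) => x Kx.
by apply: (HM (M + 1)); [rewrite ltrDl|exists x].
Qed.

(** On open sets the measure is at most the content, so slicing p into levels
gives that the integral of p is at most L p, first for 0 <= p <= 1 on K and then
for all p, since both sides agree on constants.  Applied to -p, this is
equality. *)
Theorem riesz_moment : moment_functional K L.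
Proof.
have [Lam [LamD LamZ Lam_le LamL]] := positive_extension Lpos pfun_bounded.
have bI (A : set T) : bounded_on K (\1_A : T -> R).
  by exists 1 => x _; rewrite indicE; case: (_ \in _); rewrite ?normr1 ?normr0.
have bp p : bounded_on K (pfun p) by exact: pfun_bounded.
have Lam0 : Lam (pfun 0) = 0 by rewrite LamL linear0.
pose m (A : set T) : R := Lam \1_A.
have m_ge0 A : 0 <= m A.
  rewrite -Lam0; apply: Lam_le => // x _.
  by rewrite /pfun meval0 indicE; case: (_ \in _).
have mU A B : A `&` B = set0 -> m (A `|` B) = m A + m B.
  move=> AB; rewrite /m -LamD //; congr Lam; apply/funext => x.
  have nAB : ~~ ((x \in A) && (x \in B)).
    apply/negP => /andP[/set_mem Ax /set_mem Bx].
    by have : (A `&` B) x by []; rewrite AB.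
  rewrite !fctE !indicE in_setU.
  by case: (x \in A) nAB; case: (x \in B) => //= _; rewrite ?addr0 ?add0r.
have mK A : m A = m (A `&` K).
  have E1 x : K x -> \1_A x = \1_(A `&` K) x :> R.
    by move=> Kx; rewrite !indicE in_setI [x \in K]mem_set // andbT.
  by apply/le_anti/andP; split; apply: Lam_le => // x Kx; rewrite E1.
pose mu := cmeasure cK m_ge0 mU mK.
have mmK : measurable (K : set (borel_rV R d)) by apply: closed_borel; exact: closedK.
have muT : m setT = L 1.
  by rewrite /m indicT -LamL; congr Lam; apply/funext => x; rewrite /pfun meval1.
have muK : mu K = (L 1)%:E by rewrite -muT; exact: cmeasure_K.
have intp p : mu.-integrable K (EFin \o (pfun p : borel_rV R d -> R)).
  apply: measurable_bounded_integrable => //.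
  - by rewrite muK ltry.
  - exact: pfun_measurable.
  have [c bc] := pfun_bounded p; exists c; split; first exact: num_real.
  by move=> y cy x Kx; apply: (le_trans (bc x Kx)); exact: ltW.
pose I p : R := \int[mu]_(x in K) pfun p x.
have IE p : (I p)%:E = (\int[mu]_(x in K) (pfun p x)%:E)%E.
  by rewrite /I /Rintegral fineK //; apply: (@integrable_fin_num _ _ _ mu K) => //; exact: intp.
have ID p q : I (p + q) = I p + I q.
  rewrite /I -RintegralD //; apply: eq_Rintegral => x _.
  by rewrite /pfun mevalD.
have IZ k p : I (k *: p) = k * I p.
  rewrite /I -RintegralZl //; apply: eq_Rintegral => x _.
  by rewrite /pfun mevalZ.
have I1 : I 1 = L 1.
  apply/EFin_inj; rewrite IE -muK -[RHS]mul1e -integral_cst //.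
  by apply: eq_integral => x _; rewrite /pfun meval1.
(* replace p by the sum of 1/n times the indicators of the open sets p > j/n *)
have layer p n : (0 < n)%N -> (forall x, K x -> 0 <= pfun p x <= 1) ->
    I p <= L p + n%:R^-1 * L 1.
  move=> n0 p01; have nR : 0 < n%:R :> R by rewrite ltr0n.
  pose U (j : nat) := [set x : T | j%:R < n%:R * pfun p x].
  have oU j : open (U j).
    have -> : U j = [set x : T | j%:R / n%:R < pfun p x].
      by apply/seteqP; split => x; rewrite /U /= ltr_pdivrMr // mulrC.
    exact: pfun_open.
  have lev x : K x -> pfun p x <= \sum_(j < n) n%:R^-1 * \1_(U j) x <= pfun p x + n%:R^-1.
    move=> Kx; rewrite -mulr_sumr.
    have -> : \sum_(j < n) \1_(U j) x = \sum_(j < n) (j%:R < n%:R * pfun p x)%R%:R :> R.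
      by apply: eq_bigr => j _; rewrite indicE /U; congr (nat_of_bool _)%:R; apply/idP/idP; rewrite inE.
    have /andP[h1 h2] := p01 x Kx.
    have /count_levels/andP[h3 h4] : 0 <= n%:R * pfun p x <= n%:R.
      by rewrite mulr_ge0 //= ger_pMr.
    by rewrite ler_pdivlMl // h3 /= ler_pdivrMl // mulrDr divff ?gt_eqF.
  have bs (k : nat) : bounded_on K (\sum_(j < k) n%:R^-1 *: (\1_(U j) : T -> R)).
    exists (\sum_(j < k) n%:R^-1) => x _; rewrite fct_sumE.
    apply: (le_trans (ler_norm_sum _ _ _)); apply: ler_sum => j _.
    rewrite fctE normrM ger0_norm ?invr_ge0 // ler_piMr ?invr_ge0 //.
    by rewrite indicE; case: (_ \in _); rewrite ?normr1 ?normr0.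
  have LamS (k : nat) : Lam (\sum_(j < k) n%:R^-1 *: (\1_(U j) : T -> R)) =
      \sum_(j < k) n%:R^-1 * m (U j).
    elim: k => [|k IH].
      rewrite !big_ord0 -Lam0; congr Lam; apply/funext => x.
      by rewrite /pfun meval0.
    rewrite !big_ord_recr /= LamD ?IH ?LamZ //; first exact: bs.
    by exists n%:R^-1 => x _; rewrite fctE normrM ger0_norm ?invr_ge0 // ler_piMr ?invr_ge0 // indicE; case: (_ \in _); rewrite ?normr1 ?normr0.
  apply: (@le_trans _ _ (\sum_(j < n) n%:R^-1 * m (U j))); last first.
    rewrite -LamS -linearZ -linearD -LamL; apply: Lam_le => // x Kx.
    rewrite fct_sumE /pfun mevalD mevalZ meval1 mulr1.
    by have /andP[] := lev x Kx.
  rewrite -lee_fin IE.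
  have mUj j : measurable (U j : set (borel_rV R d)) by exact: open_borel.
  apply: (@le_trans _ _ (\int[mu]_(x in K) \sum_(j < n) (n%:R^-1 * \1_(U j) x)%:E)%E).
    apply: ge0_le_integral => //.
    - by move=> x Kx; rewrite lee_fin; have /andP[] := p01 x Kx.
    - by apply/measurable_EFinP; exact: pfun_measurable.
    - apply: emeasurable_sum => j; apply/measurable_EFinP.
      by apply: measurable_funM => //; exact: measurable_indic.
    - by move=> x Kx; rewrite sumEFin lee_fin; have /andP[] := lev x Kx.
  have mU1 (j : nat) : measurable_fun (K : set (borel_rV R d))
      (fun x : borel_rV R d => (n%:R^-1 * \1_(U j) x)%:E).
    by apply/measurable_EFinP; apply: measurable_funM => //; exact: measurable_indic.
  rewrite ge0_integral_sum //.
  rewrite -sumEFin; apply: lee_sum => j _.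
  under eq_integral do rewrite EFinM.
  rewrite ge0_integralZl_EFin ?invr_ge0 //; last first.
    by apply/measurable_EFinP; exact: measurable_indic.
  rewrite integral_indic // EFinM; apply: lee_wpmul2l; first by rewrite lee_fin invr_ge0.
  apply: (le_trans _ (cmeasure_open cK m_ge0 mU mK (oU j))).
  by apply: le_measure; rewrite ?inE //; exact: measurableI.
have L1 : 0 <= L 1 by apply: Lpos => x _; rewrite meval1.
have Ile (p : {mpoly R[d]}) : (forall x, K x -> 0 <= pfun p x <= 1) -> I p <= L p.
  move=> p01; apply/ler_addgt0Pr => eps eps0.
  set n := (Num.bound (L 1 / eps)).+1.
  apply: (le_trans (layer p n _ p01)) => //; rewrite lerD2l.
  rewrite ler_pdivrMl ?ltr0n // -ler_pdivrMr //; apply: ltW.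
  have := archi_boundP (divr_ge0 L1 (ltW eps0)).
  by move/lt_le_trans; apply; rewrite ler_nat leqnSn.
have Ile_all p : I p <= L p.
  have [c bc] := pfun_bounded p; pose k := `|c| + 1.
  have k0 : 0 < k by rewrite ltr_wpDl.
  have ck : c <= k by have := ler_norm c; rewrite /k; lra.
  have q01 x : K x -> 0 <= pfun ((2 * k)^-1 *: (p + k *: 1)) x <= 1.
    move=> /bc; rewrite ler_norml => /andP[h1 h2].
    rewrite /pfun mevalZ mevalD mevalZ meval1 mulr1.
    rewrite ler_pdivlMl ?mulr_gt0 // ler_pdivrMl ?mulr_gt0 // mulr0 mulr1.
    by apply/andP; split; lra.
  have := Ile _ q01.
  rewrite IZ ID IZ I1 linearZ linearD linearZ /= ler_pM2l ?invr_gt0 ?mulr_gt0 //.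
  by rewrite lerD2r.
exists mu; split.
- exact: cmeasure_radon.
- exact: cmeasure_setCK.
move=> p; split; first exact: intp.
rewrite -IE; congr EFin; apply/le_anti/andP; split; last exact: Ile_all.
by have := Ile_all ((-1) *: p); rewrite IZ linearZ /= !mulN1r lerN2.
Qed.

End Riesz.

(** * The semiring generated by the constraints and finitely many squares *)

Section PositiveCombinations.
Variables (R : realType) (A : comAlgType R).

(** Combinations with positive coefficients as an inductive predicate, for which
closure under products is a double induction. *)
Inductive pos_comb (mon : set A) : A -> Prop :=
| pos_comb0 : pos_comb mon 0
| pos_combD (alpha : R) (m q : A) :
    0 < alpha -> mon m -> pos_comb mon q -> pos_comb mon (alpha *: m + q).

Lemma pos_comb_semiring (mon : set A) : mon 1 ->
  (forall m m', mon m -> mon m' -> mon (m * m')) -> is_semiring (pos_comb mon).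
Proof.
move=> mon1 monM.
have D a b : pos_comb mon a -> pos_comb mon b -> pos_comb mon (a + b).
  move=> Ha Hb; elim: Ha => [|alpha m q a0 mm _ IH]; first by rewrite add0r.
  by rewrite -addrA; exact: pos_combD.
have Z (k : R) a : 0 <= k -> pos_comb mon a -> pos_comb mon (k *: a).
  rewrite le_eqVlt => /orP[/eqP <- _|k0]; first by rewrite scale0r; exact: pos_comb0.
  elim=> [|alpha m q a0 mm _ IH]; first by rewrite scaler0; exact: pos_comb0.
  by rewrite scalerDr scalerA; apply: pos_combD => //; exact: mulr_gt0.
split.
- by split => //; exists 0; exact: pos_comb0.
- rewrite -[1]scale1r -[X in pos_comb _ X]addr0.
  by apply: pos_combD => //; exact: pos_comb0.
- move=> a b Ha Hb; elim: Ha => [|alpha m q a0 mm _ IH].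
    by rewrite mul0r; exact: pos_comb0.
  rewrite mulrDl; apply: D => //; rewrite -scalerAl; apply: Z; first exact: ltW.
  elim: Hb {IH} => [|beta m' q' b0 mm' _ IH]; first by rewrite mulr0; exact: pos_comb0.
  by rewrite mulrDr -scalerAr; apply: pos_combD => //; exact: monM.
Qed.

Lemma mon_pos_comb (mon : set A) m : mon m -> pos_comb mon m.
Proof.
move=> mm; rewrite -[m]scale1r -[X in pos_comb _ X]addr0.
by apply: pos_combD => //; exact: pos_comb0.
Qed.

Lemma pos_comb_ge0 (mon : set A) (L : {scalar A}) :
  (forall m, mon m -> 0 <= L m) -> forall q, pos_comb mon q -> 0 <= L q.
Proof.
move=> L0 q; elim=> [|alpha m {}q a0 mm _ IH]; first by rewrite linear0.
by rewrite linearD linearZ /= addr_ge0 // mulr_ge0 ?L0 // ltW.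
Qed.

Lemma pos_comb_sum (I : Type) (mon : I -> A) q :
  pos_comb (range mon) q -> exists (N : nat) (alpha : 'I_N -> R) (i : 'I_N -> I),
    (forall t, 0 < alpha t) /\ q = \sum_(t < N) alpha t *: mon (i t).
Proof.
elim=> [|a m {}q a0 [i0 _ <-] _ [N [alpha [i [alpha0 ->]]]]].
  exists 0%N, (fun=> 1), (fun t : 'I_0 => False_rect I (notF (ltn_ord t))).
  by split => [[]//|]; rewrite big_ord0.
exists N.+1, (fun t => if unlift ord0 t is Some t' then alpha t' else a),
  (fun t => if unlift ord0 t is Some t' then i t' else i0); split.
  by move=> t; case: unliftP.
rewrite big_ord_recl unlift_none; congr (_ + _).
by apply: eq_bigr => t _; rewrite liftK.
Qed.

End PositiveCombinations.

Section Monomials.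
Variables (R : realType) (d r s : nat).
Variables (f : 'I_r -> {mpoly R[d]}) (p : 'I_s -> {mpoly R[d]}).

Definition smon (t : ('I_r -> bool) * ('I_r -> nat) * ('I_s -> nat)) :=
  semiring_monomial f p t.1.1 t.1.2 t.2.

(** Two odd exponents of f_i add up to one more square, which is the term
e && e'. *)
Lemma smonM t t' : smon t * smon t' =
  smon (fun i => t.1.1 i (+) t'.1.1 i,
        fun i => (t.1.2 i + t'.1.2 i + (t.1.1 i && t'.1.1 i))%N,
        fun j => (t.2 j + t'.2 j)%N).
Proof.
case: t => [[e n] k]; case: t' => [[e' n'] k']; rewrite /smon /semiring_monomial /=.
rewrite mulrACA; congr (_ * _); last first.
  by rewrite -big_split; apply: eq_bigr => j _ /=; rewrite mulnDr exprD.
rewrite -!big_split; apply: eq_bigr => i _ /=; rewrite -!exprD; congr (_ ^+ _).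
by case: (e i); case: (e' i) => /=; lia.
Qed.

Lemma smon1 : smon (fun=> false, fun=> 0%N, fun=> 0%N) = 1.
Proof.
by rewrite /smon /semiring_monomial /= !big1 ?mulr1 // => *; rewrite ?muln0 expr0.
Qed.

Lemma smon_f i : smon (fun j => j == i, fun=> 0%N, fun=> 0%N) = f i.
Proof.
rewrite /smon /semiring_monomial /= (bigD1 i) //= eqxx expr1.
by rewrite !big1 ?mulr1 // => j /negPf ->.
Qed.

Lemma smon_p j : smon (fun=> false, fun=> 0%N, fun i => (i == j) : nat) = p j ^+ 2.
Proof.
rewrite /smon /semiring_monomial /= [X in _ * X](bigD1 j) //= eqxx muln1.
by rewrite !big1 ?mulr1 ?mul1r // => i /negPf ->.
Qed.

Lemma semiring_gen_pos_comb q :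
  semiring_gen (range f `|` range (fun j => p j ^+ 2)) q ->
  pos_comb (range smon) q.
Proof.
apply: semiring_gen_min.
  apply: pos_comb_semiring; first by rewrite -smon1; exists (fun=> false, fun=> 0%N, fun=> 0%N).
  by move=> _ _ [t _ <-] [t' _ <-]; rewrite smonM; eexists.
move=> _ [[i _ <-]|[j _ <-]]; apply: mon_pos_comb.
  by rewrite -smon_f; eexists.
by rewrite -smon_p; eexists.
Qed.

End Monomials.

(** K is compact, so sum x_i^2 is bounded on it. *)
Lemma archimedean_squares (R : realType) (d r : nat)
    (f : 'I_r -> {mpoly R[d]}) (hK : compact (semialg_set f)) :
  archimedean (semiring_gen
    (range f `|` range (fun p : {mpoly R[d]} => p ^+ 2))).
Proof.
set T := semiring_gen _.
have semT : is_semiring T by exact: semiring_gen_semiring.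
have sqT p : T (p ^+ 2) by apply: sub_semiring_gen; right; exists p.
have [c bc] := pfun_bounded hK (\sum_i mpolyX R (mnm1 i) ^+ 2).
apply: (@archimedean_preordering _ _ T (codom f) (c + 1)) => //.
  by move=> _ /codomP[i ->]; apply: sub_semiring_gen; left; exists i.
move=> x fx; pose v : 'rV[R]_d := \row_i x i.
have vE p : p.@[v ord0] = p.@[x] by apply: meval_eq => i; rewrite mxE.
have /bc : semialg_set f v by move=> i; rewrite vE fx ?codom_f.
rewrite vE => /(le_trans (ler_norm _)) h; rewrite ltr_pwDr //.
move: h; rewrite raddf_sum; congr (_ <= _); apply: eq_bigr => i _.
by rewrite /= !expr2 mevalM mevalXU.
Qed.

Theorem theorem4p2 (R : realType) (d r : nat) (hd : (0 < d)%N) (hr : (0 < r)%N)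
    (f : 'I_r -> {mpoly R[d]}) (hK : compact (semialg_set f)) :
  exists (s : nat) (p : 'I_s -> {mpoly R[d]}),
    [/\ (0 < s)%N,
        archimedean (semiring_gen (range f `|` range (fun j => p j ^+ 2))),
        forall q : {mpoly R[d]},
          (forall x, semialg_set f x -> 0 < q.@[x ord0]) ->
          exists (N : nat) (alpha : 'I_N -> R) (e : 'I_N -> 'I_r -> bool)
                 (n : 'I_N -> 'I_r -> nat) (k : 'I_N -> 'I_s -> nat),
            (forall t, 0 < alpha t) /\
            q = \sum_(t < N)
                  alpha t *: semiring_monomial f p (e t) (n t) (k t)
      & forall L : {scalar {mpoly R[d]}},
          (forall (e : 'I_r -> bool) (n : 'I_r -> nat) (k : 'I_s -> nat),
             0 <= L (semiring_monomial f p e n k)) ->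
          moment_functional (semialg_set f) L].
Proof.
have archT := archimedean_squares hK.
pose W (ps : seq {mpoly R[d]}) :=
  semiring_gen (range f `|` [set p ^+ 2 | p in [set` ps]]).
have Wmono (ps ps' : seq {mpoly R[d]}) : {subset ps <= ps'} -> W ps `<=` W ps'.
  move=> ss; apply: semiring_gen_mono => x [Gx|[p pps <-]]; [by left|right].
  by exists p => //=; exact: ss.
(* only finitely many squares are needed to bound each of the variables *)
have /choice[ps psP] (i : 'I_d) : exists ps, bounded_elt (W ps) (mpolyX R (mnm1 i)).
  have [k k0 [/semiring_gen_finite_squares[ps1 h1]
    /semiring_gen_finite_squares[ps2 h2]]] := archT (mpolyX R (mnm1 i)).
  exists (ps1 ++ ps2), k => //; split.
    by apply: Wmono h1 => x; rewrite mem_cat => ->.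
  by apply: Wmono h2 => x; rewrite mem_cat orbC => ->.
pose l := 1 :: flatten (codom ps); pose s := size l.
pose p (j : 'I_s) : {mpoly R[d]} := nth 1 l j.
set S := semiring_gen (range f `|` range (fun j => p j ^+ 2)).
have semS : is_semiring S by exact: semiring_gen_semiring.
have WS i : W (ps i) `<=` S.
  apply: semiring_gen_mono => x [Gx|[q /= qps <-]]; [by left|right].
  have ql : q \in l by rewrite inE; apply/orP; right; apply/flattenP; exists (ps i) => //; exact: codom_f.
  have sq : (index q l < s)%N by rewrite index_mem.
  by exists (Ordinal sq) => //; rewrite /p nth_index.
have archS : archimedean S.
  apply: archimedean_of_vars => // i.
  by have [k k0 [h1 h2]] := psP i; exists k => //; split; exact: (WS i).
have posS q : (forall x, semialg_set f x -> 0 < q.@[x ord0]) -> S q.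
  move=> qpos; apply: archimedean_positivstellensatz => // x xS.
  pose v : 'rV[R]_d := \row_i x i.
  have vE g : g.@[v ord0] = g.@[x] by apply: meval_eq => i; rewrite mxE.
  rewrite -vE; apply: qpos => i; rewrite vE; apply: xS.
  by apply: sub_semiring_gen; left; exists i.
exists s, p; split => //.
- move=> q /posS/semiring_gen_pos_comb/pos_comb_sum[N [alpha [t [alpha0 ->]]]].
  by exists N, alpha, (fun j => (t j).1.1), (fun j => (t j).1.2), (fun j => (t j).2).
- move=> L L0.
  have LS q : S q -> 0 <= L q.
    move=> /semiring_gen_pos_comb; apply: pos_comb_ge0 => _ [t _ <-].
    exact: L0.
  apply: riesz_moment => // q q0; apply/ler_addgt0Pr => eps eps0.
  have L1 : 0 <= L 1 by apply: LS; exact: semiring1.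
  have e0 : 0 < eps / (L 1 + 1) by rewrite divr_gt0 // ltr_wpDl.
  have : 0 <= L (q + (eps / (L 1 + 1)) *: 1).
    apply: LS; apply: posS => x /q0 qx; rewrite mevalD mevalZ meval1 mulr1.
    exact: ltr_wpDl.
  rewrite linearD linearZ /= => h; apply: (le_trans h); rewrite lerD2l.
  rewrite mulrAC ler_pdivrMr ?ltr_wpDl //.
  by apply: ler_wpM2l; [exact: ltW|rewrite lerDl].
Qed.
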